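(* If $\Lambda=KQ/I$ is an algebra of generalized quaternion type, then its Cartan matrix $C=C_\Lambda$ satisfies the identity $$\operatorname{Ad}_Q\cdot C=0.$$
   Context: $K$ is an algebraically closed field; an algebra is a basic finite-dimensional associative $K$-algebra; modules are finitely generated right modules. An algebra of generalized quaternion type is an indecomposable tame symmetric algebra of infinite representation type all of whose simple modules are periodic of period $4$ (i.e. for each simple $S$, $4$ is the smallest $d\geqslant 1$ with $\Omega^d(S)\cong S$, where $\Omega$ is the syzygy operator). $\Lambda=KQ/I$ is a presentation with $I$ an admissible ideal, so $Q$ is the Gabriel quiver of $\Lambda$, with vertex set $\{1,\dots,n\}$ and corresponding primitive idempotents $e_1,\dots,e_n$. The Cartan matrix is $C_\Lambda=[c_{ij}]$ with $c_{ij}=\dim_K e_j\Lambda e_i$, so that its columns are the dimension vectors of the indecomposable projectives $P_i=e_i\Lambda$. The signed adjacency matrix is $\operatorname{Ad}_Q=\operatorname{Ar}_Q-\operatorname{Ar}_Q^T$, where $\operatorname{Ar}_Q=[q_{ij}]$ and $q_{ij}$ is the number of arrows $i\to j$ in $Q$. *)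

(* Defs.v *)
From HB Require Import structures.
From mathcomp Require Import all_boot all_order all_algebra all_field.
From mathcomp Require Import finmap monalg.

Set Implicit Arguments.
Unset Strict Implicit.
Unset Printing Implicit Defensive.

Import GRing.Theory.
Local Open Scope ring_scope.

Record quiver (n : nat) := Quiver {
  arrow : finType;
  src : arrow -> 'I_n;
  tgt : arrow -> 'I_n }.

Section Paths.
Variables (n : nat) (Q : quiver n).

Fixpoint is_walk (i : 'I_n) (s : seq (arrow Q)) : bool :=
  if s is a :: s' then (src a == i) && is_walk (tgt a) s' else true.

Fixpoint walk_end (i : 'I_n) (s : seq (arrow Q)) : 'I_n :=
  if s is a :: s' then walk_end (tgt a) s' else i.

(* The starting vertex is kept in order to distinguish the trivial paths. *)
Record qpath := QPath {
  qpath_val : 'I_n * seq (arrow Q);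
  _ : is_walk qpath_val.1 qpath_val.2 }.

HB.instance Definition _ := [isSub for qpath_val].
HB.instance Definition _ := [Choice of qpath by <:].

Definition psrc (p : qpath) : 'I_n := (val p).1.
Definition parrows (p : qpath) : seq (arrow Q) := (val p).2.
Definition ptgt (p : qpath) : 'I_n := walk_end (psrc p) (parrows p).
Definition plength (p : qpath) : nat := size (parrows p).

Definition trivial_path (i : 'I_n) : qpath := @QPath (i, [::]) isT.

(* First p, then q; None if p does not end where q starts. *)
Definition pcat (p q : qpath) : option qpath :=
  if ptgt p == psrc q then insub (psrc p, parrows p ++ parrows q) else None.

Lemma is_walk_cat i s t :
  is_walk i (s ++ t) = is_walk i s && is_walk (walk_end i s) t.
Proof. by elim: s i => //= a s IH i; rewrite IH andbA. Qed.

Lemma walk_end_cat i s t : walk_end i (s ++ t) = walk_end (walk_end i s) t.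
Proof. by elim: s i => /=. Qed.

Lemma pcatP p q : ptgt p = psrc q ->
  exists2 r, pcat p q = Some r &
    [/\ psrc r = psrc p, parrows r = parrows p ++ parrows q & ptgt r = ptgt q].
Proof.
move=> e; rewrite /pcat e eqxx.
have w : is_walk (psrc p) (parrows p ++ parrows q).
  by rewrite is_walk_cat (valP p) /= -/(ptgt p) e (valP q).
exists (@QPath (psrc p, parrows p ++ parrows q) w); first by rewrite insubT.
by split=> //; rewrite {1}/ptgt /= walk_end_cat -/(ptgt p) e.
Qed.

Lemma pcatN p q : ptgt p != psrc q -> pcat p q = None.
Proof. by rewrite /pcat => /negPf->. Qed.

Lemma qpath_eq p q : psrc p = psrc q -> parrows p = parrows q -> p = q.
Proof.
move=> e1 e2; apply: val_inj; move: e1 e2; rewrite /psrc /parrows.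
by case: (val p) (val q) => [? ?] [? ?] /= -> ->.
Qed.

Lemma pcatA p q r :
  obind (pcat p) (pcat q r) = obind (fun s => pcat s r) (pcat p q).
Proof.
case: (eqVneq (ptgt p) (psrc q)) => [e1|n1]; case: (eqVneq (ptgt q) (psrc r)) => [e2|n2].
- have [s Es [s1 s2 s3]] := pcatP e1; have [t Et [t1 t2 t3]] := pcatP e2.
  rewrite Es Et /=.
  have [|u -> [u1 u2 _]] := @pcatP p t; first by rewrite t1.
  have [|v -> [v1 v2 _]] := @pcatP s r; first by rewrite s3.
  congr Some; apply: qpath_eq; first by rewrite u1 v1.
  by rewrite u2 v2 s2 t2 catA.
- have [s Es [s1 s2 s3]] := pcatP e1.
  by rewrite Es (pcatN n2) /= pcatN // s3.
- have [t Et [t1 t2 t3]] := pcatP e2.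
  by rewrite Et (pcatN n1) /= pcatN // t1.
- by rewrite !pcatN.
Qed.

Lemma pcat_triv i p : pcat (trivial_path i) p = if i == psrc p then Some p else None.
Proof.
case: eqP => [->|/eqP ne]; last by rewrite pcatN.
have [|r -> [r1 r2 _]] := @pcatP (trivial_path (psrc p)) p; first by [].
by congr Some; apply: qpath_eq.
Qed.

Lemma pcatr_triv i p : pcat p (trivial_path i) = if ptgt p == i then Some p else None.
Proof.
case: eqP => [<-|/eqP ne]; last by rewrite pcatN.
have [|r -> [r1 r2 _]] := @pcatP p (trivial_path (ptgt p)); first by [].
by congr Some; apply: qpath_eq; rewrite // r2 cats0.
Qed.

End Paths.

Section LinearExtension.
Variables (K : fieldType) (T : choiceType) (V : lmodType K).
Implicit Types (x y : {malg K[T]}) (f g : T -> V).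

Definition malg_ext f x : V := \sum_(p <- msupp x) x@_p *: f p.

Lemma malg_extEw f x (d : {fset T}) : (msupp x `<=` d)%fset ->
  malg_ext f x = \sum_(p <- d) x@_p *: f p.
Proof.
move=> le; rewrite /malg_ext (big_fset_incl _ le) // => p _ /mcoeff_outdom->.
by rewrite scale0r.
Qed.

Lemma malg_ext_linear f : linear (malg_ext f).
Proof.
move=> a x y.
pose d := (msupp x `|` msupp y `|` msupp (a *: x + y))%fset.
have lx : (msupp x `<=` d)%fset.
  by apply/fsubsetP=> p px; rewrite !inE px.
have ly : (msupp y `<=` d)%fset.
  by apply/fsubsetP=> p px; rewrite !inE px orbT.
have lxy : (msupp (a *: x + y) `<=` d)%fset.
  by apply/fsubsetP=> p px; rewrite !in_fsetU px !orbT.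
rewrite (malg_extEw f lx) (malg_extEw f ly) (malg_extEw f lxy) scaler_sumr -big_split.
by apply: eq_bigr => p _ /=; rewrite mcoeffD mcoeffZ scalerDl scalerA.
Qed.

HB.instance Definition _ f :=
  GRing.isLinear.Build K {malg K[T]} V *:%R (malg_ext f) (malg_ext_linear f).

Lemma malg_extU f p : malg_ext f << p >> = f p.
Proof.
rewrite (@malg_extEw f _ [fset p]%fset) ?msuppU_le //.
by rewrite big_seq_fset1 mcoeffUU scale1r.
Qed.

Lemma malg_scaleU (a : K) (p : T) : << a *g p >> = a *: << p >> :> {malg K[T]}.
Proof. by apply/malgP=> q; rewrite mcoeffZ !mcoeffU mulrnAr mulr1. Qed.

Lemma malg_linear_ext (f g : {linear {malg K[T]} -> V}) :
  (forall p, f << p >> = g << p >>) -> f =1 g.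
Proof.
move=> e x; rewrite [x]monalgE !linear_sum; apply: eq_bigr => p _.
by rewrite malg_scaleU !linearZ e.
Qed.
End LinearExtension.

(* A quiver with at least one vertex, so that K Q is a nonzero ring. *)
Definition pathalg (K : fieldType) (n : nat) (Q : quiver n.+1) : Type :=
  {malg K[qpath Q]}.

HB.instance Definition _ (K : fieldType) n (Q : quiver n.+1) :=
  GRing.Lmodule.on (pathalg K Q).

(* Locked, as unfolding these in failing unifications is prohibitively slow. *)
HB.lock Definition pelt (K : fieldType) n (Q : quiver n.+1) (p : qpath Q) :
    pathalg K Q :=
  (<< p >> : {malg K[qpath Q]}).
Arguments pelt {K n Q} p.

HB.lock Definition pmul (K : fieldType) n (Q : quiver n.+1) (x y : pathalg K Q) :
    pathalg K Q :=
  \sum_(p <- msupp x) \sum_(q <- msupp y)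
    (x@_p * y@_q) *: oapp pelt 0 (pcat p q).

Section PathAlgebra.
Variables (K : fieldType) (n : nat) (Q : quiver n.+1).
Notation KQ := (pathalg K Q).
Implicit Types (p q : qpath Q) (x y z : KQ).
Local Notation pelt := (@pelt K n Q).
Local Notation pmul := (@pmul K n Q).
Local Notation omul := (oapp pelt 0).

Definition pone : KQ := \sum_(i < n.+1) pelt (trivial_path Q i).

Lemma pmulE x y :
  pmul x y = malg_ext (fun p => malg_ext (fun q => omul (pcat p q)) y) x.
Proof.
rewrite pmul.unlock; apply: eq_bigr => p _; rewrite scaler_sumr.
by apply: eq_bigr => q _; rewrite scalerA.
Qed.

Lemma pmul_linl y : linear (pmul^~ y).
Proof. by move=> a u v; rewrite !pmulE linearP. Qed.

Lemma pmul_linr x : linear (pmul x).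
Proof.
move=> a u v; rewrite !pmulE /malg_ext scaler_sumr -big_split.
apply: eq_bigr => p _ /=; rewrite -!/(malg_ext _ _) linearP scalerDr !scalerA.
by rewrite mulrC.
Qed.

Definition pmull_fun y x : KQ := pmul x y.

HB.instance Definition _ y := GRing.isLinear.Build K KQ KQ *:%R (pmull_fun y) (pmul_linl y).
HB.instance Definition _ x := GRing.isLinear.Build K KQ KQ *:%R (pmul x) (pmul_linr x).

Let pmull y : {linear KQ -> KQ} := pmull_fun y.
Let pmulr x : {linear KQ -> KQ} := pmul x.

Lemma pmulUU p q : pmul (pelt p) (pelt q) = omul (pcat p q).
Proof. by rewrite [in LHS]pelt.unlock pmulE !malg_extU. Qed.

Lemma pelt_ext (f g : {linear KQ -> KQ}) :
  (forall p, f (pelt p) = g (pelt p)) -> f =1 g.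
Proof.
by rewrite pelt.unlock; apply: (@malg_linear_ext K (qpath Q) KQ f g).
Qed.

Lemma omul_pmulr p (o : option (qpath Q)) :
  pmul (pelt p) (omul o) = omul (obind (pcat p) o).
Proof. by case: o => [q|] /=; [rewrite pmulUU|exact: (linear0 (pmulr _))]. Qed.

Lemma omul_pmull p (o : option (qpath Q)) :
  pmul (omul o) (pelt p) = omul (obind (fun q => pcat q p) o).
Proof. by case: o => [q|] /=; [rewrite pmulUU|exact: (linear0 (pmull _))]. Qed.

Lemma pmulUUU p q r : pmul (pelt p) (pmul (pelt q) (pelt r)) =
  pmul (pmul (pelt p) (pelt q)) (pelt r).
Proof.
by rewrite (pmulUU q r) (pmulUU p q) omul_pmulr omul_pmull pcatA.
Qed.

Lemma pmulA : associative pmul.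
Proof.
move=> x y z.
apply: (@pelt_ext (pmull (pmul y z)) (pmull z \o pmull y)%FUN _ x) => p /=.
apply: (@pelt_ext (pmulr (pelt p) \o pmull z)%FUN
  (pmull z \o pmulr (pelt p))%FUN _ y) => q /=.
apply: (@pelt_ext (pmulr (pelt p) \o pmulr (pelt q))%FUN
  (pmulr (pmul (pelt p) (pelt q))) _ z) => r /=.
exact: pmulUUU.
Qed.

Lemma pmul1x : left_id pone pmul.
Proof.
move=> x; apply: (@pelt_ext (pmulr pone) idfun _ x) => p /=.
rewrite -[LHS]/(pmull (pelt p) pone) linear_sum /= (bigD1 (psrc p)) //= big1 ?addr0.
  by rewrite /pmull_fun pmulUU pcat_triv eqxx.
by move=> i /negPf ne; rewrite /pmull_fun pmulUU pcat_triv ne.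
Qed.

Lemma pmulx1 : right_id pone pmul.
Proof.
move=> x; apply: (@pelt_ext (pmull pone) idfun _ x) => p /=.
rewrite -[LHS]/(pmulr (pelt p) pone) linear_sum /= (bigD1 (ptgt p)) //= big1 ?addr0.
  by rewrite pmulUU pcatr_triv eqxx.
by move=> i /negPf ne; rewrite pmulUU pcatr_triv eq_sym ne.
Qed.

Lemma pmulDl : left_distributive pmul +%R.
Proof. by move=> x y z; apply: (linearD (pmull z)). Qed.

Lemma pmulDr : right_distributive pmul +%R.
Proof. by move=> x y z; apply: (linearD (pmulr x)). Qed.

Lemma pone_neq0 : pone != 0.
Proof.
apply/eqP => e.
have := pmul1x (pelt (trivial_path Q ord0)).
rewrite e -[LHS]/(pmull _ 0) linear0 => /(congr1 (mcoeff (trivial_path Q ord0))).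
by rewrite pelt.unlock mcoeff0 mcoeffUU => /esym/eqP; rewrite oner_eq0.
Qed.

HB.instance Definition _ := GRing.Zmodule_isNzRing.Build KQ
  pmulA pmul1x pmulx1 pmulDl pmulDr pone_neq0.

Lemma pathalg_mulE x y : x * y = pmul x y.
Proof. by []. Qed.

Lemma pscaleAl (a : K) x y : a *: (x * y) = (a *: x) * y.
Proof. by rewrite -[RHS]/(pmull y (a *: x)) linearZ. Qed.

Lemma pscaleAr (a : K) x y : a *: (x * y) = x * (a *: y).
Proof. by rewrite -[RHS]/(pmulr x (a *: y)) linearZ. Qed.

HB.instance Definition _ := GRing.Lmodule_isLalgebra.Build K KQ pscaleAl.
HB.instance Definition _ := GRing.Lalgebra_isAlgebra.Build K KQ pscaleAr.

(* The m-th power of the arrow ideal has the paths of length >= m as a basis. *)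
Definition in_arrow_ideal_pow (m : nat) (x : KQ) : Prop :=
  forall p, p \in msupp x -> (m <= plength p)%N.

Definition two_sided_ideal (I : KQ -> Prop) : Prop :=
  [/\ I 0, (forall x y, I x -> I y -> I (x + y)),
      (forall x y, I y -> I (x * y)) & (forall x y, I x -> I (x * y))].

Definition admissible_ideal (I : KQ -> Prop) : Prop :=
  two_sided_ideal I /\
  exists2 m, (2 <= m)%N &
    (forall x, in_arrow_ideal_pow m x -> I x) /\
    (forall x, I x -> in_arrow_ideal_pow 2 x).

End PathAlgebra.

Section Modules.
Variables (K : closedFieldType) (A : falgType K).

(* A finite-dimensional right A-module: the space of row vectors of size mdim, *)
(* with v . a = v *m mact a; the zero module (mdim = 0) is included.           *)
Record fdmod := FdMod {
  mdim : nat;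
  mact :> {lrmorphism A -> 'M[K]_mdim} }.

Implicit Types (M N P L : fdmod).

(* The matrix f stands for the map v |-> v *m f. *)
Definition is_hom M N (f : 'M[K]_(mdim M, mdim N)) : Prop :=
  forall a, M a *m f = f *m N a.

Definition mod_iso M N : Prop :=
  exists f : 'M[K]_(mdim M, mdim N), [/\ is_hom f, row_free f & row_full f].

(* Submodules are row spaces. *)
Definition submodule M (U : 'M[K]_(mdim M)) : Prop :=
  forall a, stablemx U (M a).

Definition simple_mod M : Prop :=
  (0 < mdim M)%N /\
  forall U : 'M[K]_(mdim M), submodule U -> U = 0 \/ row_full U.

Definition indecomposable_mod M : Prop :=
  (0 < mdim M)%N /\
  forall U V : 'M[K]_(mdim M), submodule U -> submodule V ->
    row_full (U + V)%MS -> (U :&: V)%MS = 0 -> U = 0 \/ V = 0.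

Definition superfluous M (U : 'M[K]_(mdim M)) : Prop :=
  submodule U /\
  forall V : 'M[K]_(mdim M), submodule V -> row_full (U + V)%MS -> row_full V.

Definition projective_mod P : Prop :=
  forall M N (g : 'M[K]_(mdim M, mdim N)) (h : 'M[K]_(mdim P, mdim N)),
    is_hom g -> row_full g -> is_hom h ->
    exists2 k : 'M[K]_(mdim P, mdim M), is_hom k & k *m g = h.

Definition projective_cover P M (f : 'M[K]_(mdim P, mdim M)) : Prop :=
  [/\ projective_mod P, is_hom f, row_full f & superfluous (kermx f)].

(* N is isomorphic to Omega(M). *)
Definition is_syzygy M N : Prop :=
  exists P (f : 'M[K]_(mdim P, mdim M)) (i : 'M[K]_(mdim N, mdim P)),
    [/\ projective_cover f, is_hom i, row_free i & (i == kermx f)%MS].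

(* N is isomorphic to Omega^d(M). *)
Fixpoint is_syzygy_pow (d : nat) M N : Prop :=
  if d is d'.+1 then exists2 L, is_syzygy M L & is_syzygy_pow d' L N
  else mod_iso M N.

Definition periodic_of_period (d : nat) M : Prop :=
  [/\ (1 <= d)%N, is_syzygy_pow d M M &
      forall d', (1 <= d' < d)%N -> ~ is_syzygy_pow d' M M].

Definition infinite_rep_type : Prop :=
  forall (k : nat) (L : 'I_k -> fdmod),
    exists2 M, indecomposable_mod M & forall j, ~ mod_iso M (L j).

(* A K[x]-A-bimodule, on which K acts centrally, that is free of finite rank *)
(* as a left K[x]-module.                                                    *)
Record free_bimod := FreeBimod {
  brank : nat;
  bact :> {lrmorphism A -> 'M[{poly K}]_brank | polyC \; *:%R} }.

(* The right A-module K[x]/(x - lam) (x)_K[x] B *)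
Definition specialize_act (B : free_bimod) (lam : K) (a : A) : 'M[K]_(brank B) :=
  map_mx (horner_eval lam) (B a).

Lemma specialize_act_linear B lam : linear (specialize_act B lam).
Proof.
move=> c a b; rewrite /specialize_act linearP.
by apply/matrixP=> i j; rewrite !mxE /horner_eval hornerD hornerM hornerC.
Qed.

Lemma specialize_act_mult B lam : monoid_morphism (specialize_act B lam).
Proof.
by split=> [|a b]; rewrite /specialize_act ?rmorph1 ?rmorphM /= ?map_mx1 ?map_mxM.
Qed.

HB.instance Definition _ B lam := GRing.isLinear.Build K A 'M[K]_(brank B) *:%R
  (specialize_act B lam) (specialize_act_linear B lam).
HB.instance Definition _ B lam := GRing.isMonoidMorphism.Build A 'M[K]_(brank B)
  (specialize_act B lam) (specialize_act_mult B lam).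

Definition specialize (B : free_bimod) (lam : K) : fdmod :=
  FdMod (specialize_act B lam).

Definition tame : Prop :=
  forall d : nat,
    exists (k : nat) (B : 'I_k -> free_bimod) (l : nat) (L : 'I_l -> fdmod),
      forall M, indecomposable_mod M -> mdim M = d ->
        (exists i lam, mod_iso M (specialize (B i) lam)) \/
        (exists j, mod_iso M (L j)).

Definition symmetric_algebra : Prop :=
  exists B : {bilinear A -> A -> K^o},
    [/\ (forall a b c, B (a * b) c = B a (b * c)),
        (forall a b, B a b = B b a) &
        (forall a, (forall b, B a b = 0) -> a = 0)].

Definition indecomposable_algebra : Prop :=
  forall (B C : algType K) (f : {lrmorphism A -> (B * C)%type}), ~ bijective f.

Definition orthogonal_idempotents (m : nat) (e : 'I_m -> A) : Prop :=
  forall i j, e i * e j = if i == j then e i else 0.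

Definition primitive_idempotent (e : A) : Prop :=
  [/\ e * e = e, e != 0 &
      forall f g, f * f = f -> g * g = g -> f * g = 0 -> g * f = 0 ->
        e = f + g -> f = 0 \/ g = 0].

(* U and V are isomorphic right ideals. *)
Definition right_ideal_iso (U V : {vspace A}) : Prop :=
  exists h : 'End(A),
    [/\ (forall x a, x \in U -> h (x * a) = h x * a),
        (h @: U = V)%VS & (U :&: lker h = 0)%VS].

Definition basic_algebra : Prop :=
  exists (m : nat) (e : 'I_m -> A),
    [/\ orthogonal_idempotents e, (forall i, primitive_idempotent (e i)),
        \sum_i e i = 1 &
        forall i j, i != j ->
          ~ right_ideal_iso (<[e i]> * fullv)%VS (<[e j]> * fullv)%VS].

Record generalized_quaternion_type : Prop := GeneralizedQuaternionType {
  gqt_indecomposable : indecomposable_algebra;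
  gqt_tame : tame;
  gqt_symmetric : symmetric_algebra;
  gqt_infinite : infinite_rep_type;
  gqt_periodic : forall S, simple_mod S -> periodic_of_period 4 S }.

End Modules.

(* phi identifies A with KQ / I. *)
Definition presents (K : fieldType) (n : nat) (Q : quiver n.+1)
    (I : pathalg K Q -> Prop) (A : falgType K)
    (phi : {lrmorphism pathalg K Q -> A}) : Prop :=
  (forall a, exists x, phi x = a) /\ (forall x, phi x = 0 <-> I x).

Section Matrices.
Variables (n : nat) (Q : quiver n.+1).

Definition arrow_matrix : 'M[int]_n.+1 :=
  \matrix_(i, j) #|[set a : arrow Q | (src a == i) && (tgt a == j)]|%:Z.

Definition signed_adjacency : 'M[int]_n.+1 := arrow_matrix - arrow_matrix^T.

Variables (K : fieldType) (A : falgType K) (phi : {lrmorphism pathalg K Q -> A}).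

Definition vertex_idempotent (i : 'I_n.+1) : A := phi (pelt (trivial_path Q i)).

Definition cartan_matrix : 'M[int]_n.+1 :=
  \matrix_(i, j)
    (\dim (<[vertex_idempotent j]> * fullv * <[vertex_idempotent i]>)%VS)%:Z.

End Matrices.

(* Main.v *)
(* For each vertex i, periodicity turns the minimal resolution of the simple    *)
(* module S_i into an exact sequence                                            *)
(*   0 -> S_i -> P3 -> P2 -> P1 -> P0 -> S_i -> 0.                              *)
(* Here P0 = P3 = e_i A, so P1 and P2 have the same dimension vector: if p_ij   *)
(* and x_ij count the summands e_j A of P1 and P2, then p C = x C.  Minimality  *)
(* gives p_ij <= q_ij.  The map P3 -> P2 is given by elements y_b whose common  *)
(* right annihilator in e_i A lies in the socle; taking orthogonals for the     *)
(* symmetrizing form, the y_b generate (rad A) e_i as a left ideal, whence      *)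
(* x_ij >= q_ji.  Then C (q - q^T) C = C ((q - p) + (x - q^T)) C is both        *)
(* antisymmetric and nonnegative, hence zero, which forces p = q and x = q^T.   *)
From HB Require Import structures.
Require Import Defs.
From mathcomp Require Import all_boot all_order all_algebra all_field.
From mathcomp Require Import finmap monalg.
From Stdlib Require Import Classical.

Set Implicit Arguments.
Unset Strict Implicit.
Unset Printing Implicit Defensive.

Import Order.TTheory GRing.Theory Num.Theory.
Import VectorInternalTheory.
Local Open Scope ring_scope.

(** * Path coefficients and powers of the arrow ideal *)

(** The presentation enters only through a [quiver_frame] ([frame_of_presentation]), whose arrows
    form a basis of the radical modulo its square. By [projective_basis], every term of the minimal
    resolution [P3 -> P2 -> P1 -> P0] of a vertex simple [S_i] is a sum of modules [e_k A].

    Both ends are [e_i A] ([first_term], [last_term]), so additivity of dimensions gives [p C = x C]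
    for the multiplicities [p] in [P1] and [x] in [P2]. [second_term_bound] bounds [p] above by the
    arrows leaving [i]. [third_term_bound] bounds [x] below by the arrows entering [i]; it uses the
    symmetrizing form to pass from right annihilators to left ideals. The form also makes [C]
    symmetric ([corner_dimC]). [antisymmetric_squeeze] shows that these inequalities are equalities,
    and [p C = x C] becomes the claim. *)

Section PathCoefficients.
Variables (K : fieldType) (n : nat) (Q : quiver n.+1).
Notation KQ := (pathalg K Q).
Implicit Types (x y : KQ) (p q : qpath Q) (m k : nat).

Definition path_coef p x : K := mcoeff p x.

Lemma path_coef_linear p : scalar (path_coef p).
Proof. by move=> a x y; rewrite /path_coef mcoeffD mcoeffZ. Qed.

HB.instance Definition _ p :=
  GRing.isLinear.Build K KQ K *%R (path_coef p) (path_coef_linear p).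

Lemma path_coefD p x y : path_coef p (x + y) = path_coef p x + path_coef p y.
Proof. exact: linearD. Qed.

Lemma path_coefB p x y : path_coef p (x - y) = path_coef p x - path_coef p y.
Proof. exact: linearB. Qed.

Lemma path_coefZ p c x : path_coef p (c *: x) = c * path_coef p x.
Proof. exact: linearZ. Qed.

Lemma path_coef_sum p (T : finType) (F : T -> KQ) :
  path_coef p (\sum_t F t) = \sum_t path_coef p (F t).
Proof. exact: linear_sum. Qed.

Lemma path_coef_pelt p q : path_coef p (pelt q) = (q == p)%:R.
Proof. by rewrite /path_coef pelt.unlock mcoeffU. Qed.

Lemma path_coef_msupp x p : (p \in msupp x) = (path_coef p x != 0).
Proof. by rewrite mcoeff_neq0. Qed.

Lemma arrow_ideal_powP m x :
  in_arrow_ideal_pow m x <-> forall p, (plength p < m)%N -> path_coef p x = 0.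
Proof.
split=> H p; last first.
  by rewrite path_coef_msupp => ?; rewrite leqNgt; apply/negP => /H /eqP; apply/negP.
move=> lt; apply/eqP; apply/negPn; rewrite -path_coef_msupp; apply/negP => /H.
by rewrite leqNgt lt.
Qed.

Lemma arrow_ideal_pow0 m : in_arrow_ideal_pow m (0 : KQ).
Proof. by apply/arrow_ideal_powP => p _; rewrite linear0. Qed.

Lemma arrow_ideal_powD m x y : in_arrow_ideal_pow m x ->
  in_arrow_ideal_pow m y -> in_arrow_ideal_pow m (x + y).
Proof.
move=> /arrow_ideal_powP hx /arrow_ideal_powP hy.
by apply/arrow_ideal_powP => p lt; rewrite path_coefD hx // hy // addr0.
Qed.

Lemma arrow_ideal_powZ m (c : K) x :
  in_arrow_ideal_pow m x -> in_arrow_ideal_pow m (c *: x).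
Proof.
move=> /arrow_ideal_powP hx.
by apply/arrow_ideal_powP => p lt; rewrite path_coefZ hx // mulr0.
Qed.

Lemma arrow_ideal_pow_pelt p : in_arrow_ideal_pow (plength p) (pelt p : KQ).
Proof.
apply/arrow_ideal_powP => q lt; rewrite path_coef_pelt.
by case: eqP lt => // ->; rewrite ltnn.
Qed.

Lemma arrow_ideal_powS m k x :
  (m <= k)%N -> in_arrow_ideal_pow k x -> in_arrow_ideal_pow m x.
Proof.
move=> le /arrow_ideal_powP hx; apply/arrow_ideal_powP => p lt.
by apply: hx; apply: leq_trans le.
Qed.

Lemma path_expansion x : x = \sum_(p <- msupp x) path_coef p x *: pelt p.
Proof.
rewrite [LHS](monalgE x); apply: eq_bigr => p _.
by rewrite pelt.unlock malg_scaleU.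
Qed.

Lemma arrow_ideal_pow_sum m (J : eqType) (s : seq J) (F : J -> KQ) :
  (forall j, j \in s -> in_arrow_ideal_pow m (F j)) ->
  in_arrow_ideal_pow m (\sum_(j <- s) F j).
Proof.
move=> H; rewrite big_seq; apply: big_ind => //; first exact: arrow_ideal_pow0.
exact: arrow_ideal_powD.
Qed.

Lemma arrow_ideal_powM m k x y : in_arrow_ideal_pow m x ->
  in_arrow_ideal_pow k y -> in_arrow_ideal_pow (m + k) (x * y).
Proof.
move=> hx hy; rewrite pathalg_mulE pmul.unlock.
apply: arrow_ideal_pow_sum => p px; apply: arrow_ideal_pow_sum => q qy.
apply: arrow_ideal_powZ; have [e|ne] := eqVneq (ptgt p) (psrc q); last first.
  by rewrite pcatN //; apply: arrow_ideal_pow0.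
have [r -> [_ er _]] := pcatP e.
apply: (arrow_ideal_powS (k := plength r)); last exact: arrow_ideal_pow_pelt.
by rewrite /plength er size_cat leq_add ?hx ?hy.
Qed.

Definition arrow_path (a : arrow Q) : qpath Q :=
  @QPath _ Q (src a, [:: a]) (introT andP (conj (eqxx (src a)) isT)).

Lemma psrc_triv (i : 'I_n.+1) : psrc (trivial_path Q i) = i. Proof. by []. Qed.

Lemma trivial_path_inj : injective (trivial_path Q).
Proof. by move=> i j /(congr1 (@psrc _ _)). Qed.

Lemma arrow_path_inj : injective arrow_path.
Proof. by move=> a b /(congr1 (@parrows _ _)) [->]. Qed.

Lemma plength0 p : plength p = 0%N -> p = trivial_path Q (psrc p).
Proof. by move=> /size0nil e; apply: qpath_eq. Qed.

Lemma plength1 p : plength p = 1%N -> exists a, p = arrow_path a.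
Proof.
rewrite /plength => e; case E: (parrows p) e => [|a [|//]] // _.
exists a; apply: qpath_eq => //.
by have := valP p; rewrite /= -/(parrows p) -/(psrc p) E /= andbT => /eqP.
Qed.

Lemma plength_gt0 p : (0 < plength p)%N ->
  exists a, exists2 q, pelt p = pelt (arrow_path a) * pelt q :> KQ &
    plength p = (plength q).+1.
Proof.
rewrite /plength; case E: (parrows p) => [//|a s] _.
have := valP p; rewrite /= -/(parrows p) -/(psrc p) E /= => /andP[/eqP e w].
pose q := @QPath _ Q (tgt a, s) w.
exists a; exists q => //; rewrite pathalg_mulE pmulUU.
have [|r -> [r1 r2 _] /=] := @pcatP _ _ (arrow_path a) q; first by [].
by congr pelt; apply: qpath_eq; rewrite ?r1 ?r2 ?E.
Qed.

Lemma path_coef_sum_pelt (T : finType) (f : T -> qpath Q) (mu : T -> K) t :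
  injective f -> path_coef (f t) (\sum_s mu s *: pelt (f s)) = mu t.
Proof.
move=> fI; rewrite path_coef_sum (bigD1 t) // big1 => [|s ne].
  by rewrite /= path_coefZ path_coef_pelt eqxx mulr1 addr0.
by rewrite path_coefZ path_coef_pelt (inj_eq fI) (negPf ne) mulr0.
Qed.

Lemma arrow_ideal_head0 x : in_arrow_ideal_pow 1
  (x - \sum_i path_coef (trivial_path Q i) x *: pelt (trivial_path Q i)).
Proof.
apply/arrow_ideal_powP => p; rewrite ltnS leqn0 => /eqP /plength0 ->.
by rewrite path_coefB (path_coef_sum_pelt _ _ trivial_path_inj) subrr.
Qed.

Lemma arrow_ideal_head1 x : in_arrow_ideal_pow 1 x -> in_arrow_ideal_pow 2
  (x - \sum_a path_coef (arrow_path a) x *: pelt (arrow_path a)).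
Proof.
move=> /arrow_ideal_powP hx; apply/arrow_ideal_powP => p.
rewrite ltnS leq_eqVlt => /orP[/eqP /plength1 [a ->]|lt].
  by rewrite path_coefB (path_coef_sum_pelt _ _ arrow_path_inj) subrr.
rewrite path_coefB hx // path_coef_sum big1 ?subrr // => a _.
rewrite path_coefZ path_coef_pelt.
by case: eqP lt => [<-//|_ _]; rewrite mulr0.
Qed.

Lemma arrow_ideal_factor m x : in_arrow_ideal_pow m.+1 x ->
  exists2 s : arrow Q -> KQ, (forall a, in_arrow_ideal_pow m (s a)) &
    x = \sum_a pelt (arrow_path a) * s a.
Proof.
move=> hx; rewrite (path_expansion x) big_seq.
pose fact y := exists2 s : arrow Q -> KQ,
  (forall a, in_arrow_ideal_pow m (s a)) & y = \sum_a pelt (arrow_path a) * s a.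
apply: (big_ind fact) => [|y z [s sJ ->] [t tJ ->]|p px].
- exists (fun=> 0) => [a|]; first exact: arrow_ideal_pow0.
  by rewrite big1 // => a _; rewrite mulr0.
- exists (fun a => s a + t a) => [a|]; first exact: arrow_ideal_powD.
  by rewrite -big_split; apply: eq_bigr => a _; rewrite mulrDr.
have lt := hx _ px.
have [a [q Ep El]] := plength_gt0 (leq_trans (ltn0Sn _) lt).
exists (fun b => if b == a then path_coef p x *: pelt q else 0) => [b|].
  case: ifP => _; last exact: arrow_ideal_pow0.
  apply: arrow_ideal_powZ; apply: (arrow_ideal_powS (k := plength q)).
    by rewrite -ltnS -El.
  exact: arrow_ideal_pow_pelt.
rewrite (bigD1 a) //= eqxx big1 ?addr0; last by move=> b /negPf->; rewrite mulr0.
by rewrite -scalerAr -Ep.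
Qed.

End PathCoefficients.

Section TrivialCoefficient.
Variables (K : fieldType) (n : nat) (Q : quiver n.+1).
Notation KQ := (pathalg K Q).
Implicit Types (x y : KQ) (i j : 'I_n.+1).

Local Notation triv i := (pelt (trivial_path Q i) : KQ).
Local Notation head x := (\sum_i path_coef (trivial_path Q i) x *: triv i).

Lemma trivial_mul i j : triv i * triv j = if i == j then triv i else 0.
Proof. by rewrite pathalg_mulE pmulUU pcat_triv psrc_triv; case: eqP => [->|]. Qed.

Lemma trivial_arrow_mul i (a : arrow Q) :
  triv i * pelt (arrow_path a) = if i == src a then pelt (arrow_path a) else 0.
Proof. by rewrite pathalg_mulE pmulUU pcat_triv /psrc /=; case: eqP. Qed.

Lemma arrow_trivial_mul i (a : arrow Q) :
  pelt (arrow_path a) * triv i = if tgt a == i then pelt (arrow_path a) else 0.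
Proof. by rewrite pathalg_mulE pmulUU pcatr_triv /ptgt /=; case: eqP. Qed.

Lemma path_coef_trivial_pow1 i x :
  in_arrow_ideal_pow 1 x -> path_coef (trivial_path Q i) x = 0.
Proof. by move/arrow_ideal_powP; apply. Qed.

(** Modulo the arrow ideal, [KQ] is a product of copies of [K] indexed by the vertices, and this
    coefficient is one of the projections. *)
Lemma path_coef_trivialM i x y : path_coef (trivial_path Q i) (x * y) =
  path_coef (trivial_path Q i) x * path_coef (trivial_path Q i) y.
Proof.
have hx := @arrow_ideal_head0 _ _ _ x; have hy := @arrow_ideal_head0 _ _ _ y.
have -> : x * y = head x * head y + (head x * (y - head y) + (x - head x) * y).
  by rewrite mulrBr mulrBl [_ + (_ - head x * y)]addrC subrKA addrC subrK.
rewrite path_coefD [X in _ + X]path_coef_trivial_pow1 ?addr0; last first.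
  apply: arrow_ideal_powD; last exact: (@arrow_ideal_powM _ _ _ 1 0).
  exact: (@arrow_ideal_powM _ _ _ 0 1).
have -> : head x * head y = \sum_j (path_coef (trivial_path Q j) x *
    path_coef (trivial_path Q j) y) *: triv j.
  rewrite mulr_suml; apply: eq_bigr => j _; rewrite mulr_sumr (bigD1 j) //= big1.
    by rewrite addr0 -scalerAl -scalerAr trivial_mul eqxx scalerA.
  move=> k ne; rewrite -scalerAl -scalerAr trivial_mul eq_sym (negPf ne).
  by rewrite !scaler0.
by rewrite (path_coef_sum_pelt _ _ (@trivial_path_inj _ Q)).
Qed.

Lemma path_coef_trivial1 i : path_coef (trivial_path Q i) (1 : KQ) = 1.
Proof.
have -> : (1 : KQ) = \sum_j 1 *: triv j by apply: eq_bigr => j _; rewrite scale1r.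
by rewrite (path_coef_sum_pelt _ _ (@trivial_path_inj _ Q)).
Qed.

End TrivialCoefficient.

(* What the module theory uses of a presentation A = KQ/I: [qf_pow m] is the   *)
(* image of the m-th power of the arrow ideal, so [qf_pow 1] is the radical,   *)
(* and [qf_chi i] is the character through which A acts on the i-th simple.    *)
Record quiver_frame (K : fieldType) (A : falgType K) (n : nat) (Q : quiver n)
    (e : 'I_n -> A) := QuiverFrame {
  qf_pow : nat -> A -> Prop;
  qf_arrow : arrow Q -> A;
  qf_chi : 'I_n -> A -> K;
  qf_idem : forall i j, e i * e j = if i == j then e i else 0;
  qf_sum1 : \sum_i e i = 1;
  qf_chi_linear : forall i, scalar (qf_chi i);
  qf_chi_morphism : forall i, monoid_morphism (qf_chi i);
  qf_chi_idem : forall i j, qf_chi i (e j) = (i == j)%:R;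
  qf_chi_pow1 : forall i a, qf_pow 1 a -> qf_chi i a = 0;
  qf_head0 : forall a, qf_pow 1 (a - \sum_i qf_chi i a *: e i);
  qf_pow_all0 : forall a, qf_pow 0 a;
  qf_powD : forall m a b, qf_pow m a -> qf_pow m b -> qf_pow m (a + b);
  qf_powM : forall m k a b, qf_pow m a -> qf_pow k b -> qf_pow (m + k) (a * b);
  qf_nilpotent : exists m, forall a, qf_pow m a -> a = 0;
  qf_arrow_pow1 : forall a, qf_pow 1 (qf_arrow a);
  qf_idem_arrow : forall i a,
    e i * qf_arrow a = if i == src a then qf_arrow a else 0;
  qf_arrow_idem : forall i a,
    qf_arrow a * e i = if tgt a == i then qf_arrow a else 0;
  qf_head1 : forall r, qf_pow 1 r ->
    exists mu : arrow Q -> K, qf_pow 2 (r - \sum_a mu a *: qf_arrow a);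
  qf_arrow_free : forall mu : arrow Q -> K,
    qf_pow 2 (\sum_a mu a *: qf_arrow a) -> forall a, mu a = 0;
  qf_factor : forall r, qf_pow 2 r ->
    exists2 s : arrow Q -> A, (forall a, qf_pow 1 (s a)) &
      r = \sum_a qf_arrow a * s a }.

(** * The frame of an admissible presentation *)

Section FrameOfPresentation.
Variables (K : fieldType) (n : nat) (Q : quiver n.+1) (I : pathalg K Q -> Prop).
Variables (A : falgType K) (phi : {lrmorphism pathalg K Q -> A}).
Hypotheses (adm : admissible_ideal I) (pres : presents I phi).
Notation KQ := (pathalg K Q).
Implicit Types (x y : KQ) (i : 'I_n.+1).

Let J m a := exists2 x, in_arrow_ideal_pow m x & phi x = a.

Let phiB x y : phi (x - y) = phi x - phi y. Proof. exact: rmorphB. Qed.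
Let phiD x y : phi (x + y) = phi x + phi y. Proof. exact: rmorphD. Qed.
Let phiM x y : phi (x * y) = phi x * phi y. Proof. exact: rmorphM. Qed.
Let phiZ c x : phi (c *: x) = c *: phi x. Proof. exact: linearZ. Qed.
Let phi0 : phi 0 = 0. Proof. exact: rmorph0. Qed.
Let phi1 : phi 1 = 1. Proof. exact: rmorph1. Qed.
Let phi_sum (T : finType) (F : T -> KQ) : phi (\sum_t F t) = \sum_t phi (F t).
Proof. exact: rmorph_sum. Qed.

Lemma presentation_surj (a : A) : exists x, phi x == a.
Proof. by have [surj _] := pres; have [x <-] := surj a; exists x. Qed.

(** An admissible ideal lies in the square of the arrow ideal, so coefficients on paths of length at
    most one do not depend on the representative. This makes [vertex_char] independent of its chosen
    preimage. *)
Lemma presentation_pow2 x y : phi x = phi y -> in_arrow_ideal_pow 2 (x - y).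
Proof.
have [_ ker] := pres; have [_ [m _ [_ sub]]] := adm.
by move=> e; apply/sub/ker; rewrite phiB e subrr.
Qed.

Definition vertex_char i (a : A) : K :=
  path_coef (trivial_path Q i) (xchoose (presentation_surj a)).

Lemma vertex_charE i x : vertex_char i (phi x) = path_coef (trivial_path Q i) x.
Proof.
have /eqP e := xchooseP (presentation_surj (phi x)).
have := arrow_ideal_powS (isT : (1 <= 2)%N) (presentation_pow2 e).
move/path_coef_trivial_pow1 => /(_ i).
by rewrite path_coefB => /eqP; rewrite subr_eq0 => /eqP.
Qed.

Lemma presentation_ind (P : A -> Prop) : (forall x, P (phi x)) -> forall a, P a.
Proof. by move=> H a; have /eqP <- := xchooseP (presentation_surj a). Qed.

Lemma phi_sum_pelt (T : finType) (mu : T -> K) (f : T -> qpath Q) :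
  phi (\sum_t mu t *: pelt (f t)) = \sum_t mu t *: phi (pelt (f t)).
Proof. by rewrite phi_sum; apply: eq_bigr => t _; rewrite phiZ. Qed.

Lemma frame_of_presentation : quiver_frame Q (vertex_idempotent phi).
Proof.
apply: (@QuiverFrame _ _ _ _ _ J (fun c => phi (pelt (arrow_path c))) vertex_char).
- move=> i j; rewrite /vertex_idempotent -phiM trivial_mul.
  by case: ifP => // _; rewrite phi0.
- by rewrite /vertex_idempotent -phi_sum -[RHS]phi1.
- move=> i c; apply: presentation_ind => x; apply: presentation_ind => y.
  by rewrite -phiZ -phiD !vertex_charE path_coefD path_coefZ.
- move=> i; split; first by rewrite -phi1 vertex_charE path_coef_trivial1.
  apply: presentation_ind => x; apply: presentation_ind => y.
  by rewrite -phiM !vertex_charE path_coef_trivialM.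
- move=> i j; rewrite vertex_charE path_coef_pelt.
  by rewrite (inj_eq (@trivial_path_inj _ Q)) eq_sym.
- by move=> i _ [x hx <-]; rewrite vertex_charE path_coef_trivial_pow1.
- apply: presentation_ind => x; eexists; first exact: (@arrow_ideal_head0 _ _ _ x).
  rewrite phiB phi_sum_pelt; congr (_ - _).
  by apply: eq_bigr => i _; rewrite vertex_charE.
- by apply: presentation_ind => x; exists x.
- move=> m _ _ [x hx <-] [y hy <-]; exists (x + y); last exact: phiD.
  exact: arrow_ideal_powD.
- move=> m k _ _ [x hx <-] [y hy <-]; exists (x * y); last exact: phiM.
  exact: arrow_ideal_powM.
- have [_ [m _ [sub _]]] := adm; exists m => _ [x hx <-].
  by have [_ ker] := pres; apply/ker/sub.
- by move=> a; exists (pelt (arrow_path a)) => //; apply: (@arrow_ideal_pow_pelt _ _ _ (arrow_path a)).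
- move=> i a; rewrite -phiM trivial_arrow_mul.
  by case: ifP => // _; rewrite phi0.
- move=> i a; rewrite -phiM arrow_trivial_mul.
  by case: ifP => // _; rewrite phi0.
- move=> _ [x hx <-]; exists (fun a => path_coef (arrow_path a) x).
  eexists; first exact: arrow_ideal_head1 hx.
  by rewrite phiB phi_sum_pelt.
- move=> mu; rewrite -phi_sum_pelt => -[x hx /presentation_pow2 hd] a.
  rewrite -(path_coef_sum_pelt mu a (@arrow_path_inj _ Q)).
  (* The combination of arrows is the difference of [x] and an element of [I], both in the square of
     the arrow ideal. *)
  have := arrow_ideal_powD hx (arrow_ideal_powZ (c := -1) hd).
  rewrite scaleN1r opprB addrCA subrr addr0 => /arrow_ideal_powP; exact.
- move=> _ [x hx <-]; have [s sJ ->] := arrow_ideal_factor hx.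
  exists (fun a => phi (s a)) => [a|]; first by exists (s a).
  by rewrite phi_sum; apply: eq_bigr => a _; rewrite phiM.
Qed.

End FrameOfPresentation.

(** * Projective modules have bases *)

Section FrameTheory.
Variables (K : fieldType) (A : falgType K) (n : nat) (Q : quiver n).
Variables (e : 'I_n -> A) (F : quiver_frame Q e).
Implicit Types (a b r : A) (i j : 'I_n) (m : nat) (c : K).
Notation J := (qf_pow F).
Notation chi := (qf_chi F).

Lemma chiD i a b : chi i (a + b) = chi i a + chi i b.
Proof. by have := qf_chi_linear F i 1 a b; rewrite scale1r mul1r. Qed.

Lemma chi0 i : chi i 0 = 0.
Proof. by apply/(addrI (chi i 0)); rewrite -chiD !addr0. Qed.

Lemma chiZ i c a : chi i (c *: a) = c * chi i a.
Proof. by have := qf_chi_linear F i c a 0; rewrite addr0 chi0 addr0. Qed.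

Lemma chiB i a b : chi i (a - b) = chi i a - chi i b.
Proof. by rewrite -scaleN1r chiD chiZ mulN1r. Qed.

Lemma chiM i a b : chi i (a * b) = chi i a * chi i b.
Proof. by have [_ ->] := qf_chi_morphism F i. Qed.

Lemma chi1 i : chi i 1 = 1.
Proof. by have [->] := qf_chi_morphism F i. Qed.

Lemma pow1P a : J 1 a <-> forall i, chi i a = 0.
Proof.
split=> [h i|h]; first exact: qf_chi_pow1 h.
have := qf_head0 F a; rewrite big1 ?subr0 // => i _.
by rewrite h scale0r.
Qed.

Lemma pow0 m : J m 0.
Proof.
elim: m => [|m IH]; first exact: qf_pow_all0.
rewrite -[0](mulr0 0) -add1n; apply: qf_powM IH.
by apply/pow1P => i; rewrite chi0.
Qed.

Lemma powMl m a b : J m b -> J m (a * b).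
Proof. by apply: (@qf_powM _ _ _ _ _ F 0); apply: qf_pow_all0. Qed.

Lemma powMr m a b : J m a -> J m (a * b).
Proof. by move=> h; rewrite -[m]addn0; apply: qf_powM => //; apply: qf_pow_all0. Qed.

Lemma powZ m c a : J m a -> J m (c *: a).
Proof. by rewrite -[a in c *: a]mul1r scalerAl; apply: powMl. Qed.

Lemma powN m a : J m a -> J m (- a).
Proof. by rewrite -scaleN1r; apply: powZ. Qed.

Lemma pow_sum m (T : Type) (s : seq T) (p : pred T) (G : T -> A) :
  (forall t, p t -> J m (G t)) -> J m (\sum_(t <- s | p t) G t).
Proof. by move=> h; apply: big_ind => //; [apply: pow0|apply: qf_powD]. Qed.

Lemma idem_idem i : e i * e i = e i.
Proof. by rewrite (qf_idem F) eqxx. Qed.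

Lemma idem_head i a : J 1 (e i * a - chi i a *: e i).
Proof.
apply/pow1P => j; rewrite chiB chiM chiZ !(qf_chi_idem F) eq_sym.
by case: eqP => [->|_]; rewrite ?mul1r ?mulr1 ?mul0r ?mulr0 subrr.
Qed.

Lemma sum_idemr a : a = \sum_i a * e i.
Proof. by rewrite -mulr_sumr (qf_sum1 F) mulr1. Qed.

Lemma idem_notin_pow1 i : ~ J 1 (e i).
Proof.
by move/pow1P => /(_ i) /eqP; rewrite (qf_chi_idem F) eqxx oner_eq0.
Qed.

Lemma pow1_nilpotent r : J 1 r -> exists m, r ^+ m = 0.
Proof.
move=> hr; have [m hm] := qf_nilpotent F; exists m; apply: hm.
elim: m => [|m IH]; first exact: qf_pow_all0.
by rewrite exprS -add1n; apply: qf_powM.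
Qed.

Lemma pow1_inverse c r : c != 0 -> J 1 r -> exists b, (c%:A - r) * b = 1.
Proof.
move=> c0 hr; have [m rm] := pow1_nilpotent (powZ (c^-1) hr).
exists (c^-1 *: \sum_(k < m) (c^-1 *: r) ^+ k).
rewrite -scalerAr scalerAl scalerBr scalerA mulVf // scale1r.
have := subrX1 (c^-1 *: r) m; rewrite rm sub0r => h.
by rewrite -opprB mulNr -h opprK.
Qed.

(** A form of Nakayama's lemma: iterating [a = N a] puts each [a d] in every [J k], and these vanish
    for large [k]. *)
Lemma pow1_fixpoint m (a : 'I_m -> A) (N : 'I_m -> 'I_m -> A) :
  (forall d k, J 1 (N d k)) -> (forall d, a d = \sum_k N d k * a k) ->
  forall d, a d = 0.
Proof.
move=> hN ha d; have [k hk] := qf_nilpotent F; apply: hk; elim: k d => [|k IH] d.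
  exact: qf_pow_all0.
by rewrite ha; apply: pow_sum => l _; rewrite -add1n; apply: qf_powM.
Qed.

End FrameTheory.

(** * Module actions, free modules and dual bases *)

Section Action.
Variables (K : closedFieldType) (A : falgType K) (M : fdmod A).
Implicit Types (v : 'rV[K]_(mdim M)) (a b : A).

Lemma actD v a b : v *m M (a + b) = v *m M a + v *m M b.
Proof. by rewrite raddfD mulmxDr. Qed.

Lemma act0 v : v *m M 0 = 0.
Proof. by rewrite raddf0 mulmx0. Qed.

Lemma actB v a b : v *m M (a - b) = v *m M a - v *m M b.
Proof. by rewrite raddfB mulmxBr. Qed.

Lemma actZ v (c : K) a : v *m M (c *: a) = c *: (v *m M a).
Proof. by rewrite linearZ -scalemxAr. Qed.

Lemma act1 v : v *m M 1 = v.
Proof. by rewrite rmorph1 mulmx1. Qed.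

Lemma actM v a b : v *m M (a * b) = v *m M a *m M b.
Proof. by rewrite rmorphM -mulmxA. Qed.

Lemma act_sum v (T : finType) (G : T -> A) :
  v *m M (\sum_t G t) = \sum_t v *m M (G t).
Proof. by rewrite raddf_sum mulmx_sumr. Qed.

Lemma hom_act (N : fdmod A) (f : 'M[K]_(mdim M, mdim N)) v a :
  is_hom f -> v *m M a *m f = v *m f *m N a.
Proof. by move=> fh; rewrite -mulmxA fh mulmxA. Qed.

End Action.

Section FreeModule.
Variables (K : closedFieldType) (A : falgType K) (m : nat).
Implicit Types (a b : A) (X : 'M[K]_(m, dim A)).

Definition regular_act a : 'M[K]_(dim A) := lin1_mx (v2r \o amulr a \o r2v).

Lemma regular_actE (u : 'rV[K]_(dim A)) a : u *m regular_act a = v2r (r2v u * a).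
Proof. by rewrite mul_rV_lin1 /= lfunE. Qed.

Lemma row_vector_ext p q (X Y : 'M[K]_(p, q)) :
  (forall u : 'rV_p, u *m X = u *m Y) -> X = Y.
Proof. by move=> h; apply/row_matrixP => i; rewrite !rowE h. Qed.

(** [A^m] is stored as a flattened [m] by [dim A] matrix, one row of coordinates per copy of [A]. *)
Definition free_act a : 'M[K]_(m * dim A) := lin_mx (mulmxr (regular_act a)).

Lemma free_actE X a : mxvec X *m free_act a = mxvec (X *m regular_act a).
Proof. by rewrite mul_vec_lin. Qed.

Lemma regular_act_linear : linear regular_act.
Proof.
move=> c a b; apply: row_vector_ext => u; rewrite mulmxDr -scalemxAr !regular_actE.
by rewrite mulrDr -scalerAr linearP.
Qed.

Lemma regular_actM a b : regular_act (a * b) = regular_act a *m regular_act b.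
Proof.
by apply: row_vector_ext => u; rewrite mulmxA !regular_actE v2rK mulrA.
Qed.

Lemma regular_act1 : regular_act 1 = 1%:M.
Proof. by apply: row_vector_ext => u; rewrite regular_actE mulr1 r2vK mulmx1. Qed.

Lemma free_act_linear : linear free_act.
Proof.
move=> c a b; apply: row_vector_ext => u; rewrite -[u]vec_mxK.
rewrite mulmxDr -scalemxAr !free_actE regular_act_linear mulmxDr -scalemxAr.
by rewrite linearP.
Qed.

Lemma free_act_mult : monoid_morphism free_act.
Proof.
split=> [|a b]; apply: row_vector_ext => u; rewrite -[u]vec_mxK.
  by rewrite free_actE regular_act1 mulmx1 mulmx1.
by rewrite mulmxA !free_actE regular_actM mulmxA.
Qed.

HB.instance Definition _ :=
  GRing.isLinear.Build K A 'M[K]_(m * dim A) *:%R free_act free_act_linear.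
HB.instance Definition _ :=
  GRing.isMonoidMorphism.Build A 'M[K]_(m * dim A) free_act free_act_mult.

Definition free_mod : fdmod A := FdMod free_act.

Variables (P : fdmod A) (v : 'I_m -> 'rV[K]_(mdim P)).

Definition free_coord (c : 'I_m) (u : 'rV[K]_(m * dim A)) : A :=
  r2v (row c (vec_mx u)).

Lemma free_coord_linear c : linear (free_coord c).
Proof. by move=> t x y; rewrite /free_coord !linearP. Qed.

HB.instance Definition _ c := GRing.isLinear.Build K 'rV[K]_(m * dim A) A *:%R
  (free_coord c) (free_coord_linear c).

Lemma free_coord_act c (u : 'rV[K]_(mdim free_mod)) a :
  free_coord c (u *m free_mod a) = free_coord c u * a.
Proof.
rewrite -[X in X *m _]vec_mxK free_actE /free_coord !mxvecK row_mul.
by rewrite regular_actE v2rK.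
Qed.

Definition free_eval (u : 'rV[K]_(m * dim A)) : 'rV[K]_(mdim P) :=
  \sum_c v c *m P (free_coord c u).

Lemma free_eval_linear : linear free_eval.
Proof.
move=> t x y; rewrite /free_eval scaler_sumr -big_split; apply: eq_bigr => c _ /=.
by rewrite linearP actD actZ.
Qed.

HB.instance Definition _ := GRing.isLinear.Build K 'rV[K]_(m * dim A)
  'rV[K]_(mdim P) *:%R free_eval free_eval_linear.

Definition generates := forall x, exists a : 'I_m -> A, x = \sum_c v c *m P (a c).

(** Projectivity splits the surjection [A^m -> P] given by the generators; the [phi d] are the
    coordinates of the splitting. *)
Lemma dual_basis : projective_mod P -> generates ->
  exists phi : 'I_m -> 'rV[K]_(mdim P) -> A,
    [/\ forall d x a, phi d (x *m P a) = phi d x * a,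
        forall d x y, phi d (x + y) = phi d x + phi d y &
        forall x, x = \sum_d v d *m P (phi d x)].
Proof.
move=> projP gen.
pose g : 'M[K]_(mdim free_mod, mdim P) := lin1_mx free_eval.
have gE u : u *m g = free_eval u by rewrite mul_rV_lin1.
have g_hom : is_hom g.
  move=> a; apply: row_vector_ext => u.
  rewrite !mulmxA !gE /free_eval mulmx_suml; apply: eq_bigr => c _.
  by rewrite free_coord_act actM.
have g_full : row_full g.
  rewrite -sub1mx; apply/row_subP => i; have [a ->] := gen (row i 1%:M).
  apply/submxP; exists (mxvec (\matrix_c v2r (a c))).
  by rewrite gE; apply: eq_bigr => c _; rewrite /free_coord mxvecK rowK v2rK.
have [|k k_hom kg] := projP free_mod P g 1%:M g_hom g_full.
  by move=> a; rewrite mulmx1 mul1mx.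
exists (fun d x => free_coord d (x *m k)); split=> [d x a|d x y|x].
- by rewrite (hom_act _ _ k_hom) free_coord_act.
- by rewrite mulmxDl linearD.
- by rewrite -[LHS]mulmx1 -kg mulmxA gE.
Qed.

End FreeModule.

Section ProjectiveBasis.
Variables (K : closedFieldType) (A : falgType K) (n : nat) (Q : quiver n).
Variables (e : 'I_n -> A) (F : quiver_frame Q e).
Notation J := (qf_pow F).
Notation chi := (qf_chi F).

(* The family v exhibits P as the direct sum of the modules e_(j c) A. *)
Record idem_basis (P : fdmod A) m (j : 'I_m -> 'I_n)
    (v : 'I_m -> 'rV[K]_(mdim P)) : Prop := IdemBasis {
  idem_basis_idem : forall c, v c *m P (e (j c)) = v c;
  idem_basis_gen : generates v;
  idem_basis_free : forall a : 'I_m -> A, (forall c, e (j c) * a c = a c) ->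
    \sum_c v c *m P (a c) = 0 -> forall c, a c = 0 }.

(* The matrix expressing v through its own dual basis is the identity modulo *)
(* the radical, hence has trivial kernel.                                    *)
Lemma minimal_generators_basis (P : fdmod A) m (j : 'I_m -> 'I_n)
    (v : 'I_m -> 'rV[K]_(mdim P)) :
  projective_mod P -> (forall c, v c *m P (e (j c)) = v c) -> generates v ->
  (forall (l : 'I_m -> K) (r : 'I_m -> A), (forall c, J 1 (r c)) ->
    \sum_c l c *: v c = \sum_c v c *m P (r c) -> forall c, l c = 0) ->
  idem_basis j v.
Proof.
move=> projP vj gen min; split=> // a aj sum0.
have [phi [phiM phiD phiE]] := dual_basis projP gen.
pose B d c := e (j d) * phi d (v c).
have vB c : v c = \sum_d v d *m P (B d c).
  by rewrite [LHS]phiE; apply: eq_bigr => d _; rewrite actM vj.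
have BJ d c : J 1 (B d c - chi (j d) (phi d (v c)) *: e (j d)) by apply: idem_head.
have chiB d c : chi (j d) (phi d (v c)) = (d == c)%:R.
  apply/eqP; rewrite eq_sym -subr_eq0; apply/eqP.
  (* The relation excluded by [min] is [v c = \sum_d v d (B d c)] with the scalar parts of the
     [B d c] moved to the left. *)
  apply: (min (fun d => (d == c)%:R - chi (j d) (phi d (v c))) _ (BJ^~ c) _ d).
  transitivity (v c - \sum_d chi (j d) (phi d (v c)) *: v d).
    under eq_bigr do rewrite scalerBl; rewrite sumrB; congr (_ - _).
    by rewrite (bigD1 c) //= eqxx scale1r big1 ?addr0 // => k /negPf->; rewrite scale0r.
  rewrite [in X in X - _]vB -sumrB; apply: eq_bigr => k _.
  by rewrite actB actZ vj.
apply: (pow1_fixpoint (F := F)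
    (N := fun d c : 'I_m => (d == c)%:R *: e (j d) - B d c)) => d.
  by move=> k; rewrite -chiB -opprB; apply: powN; apply: BJ.
have phi0 : phi d 0 = 0 by apply/(addrI (phi d 0)); rewrite -phiD !addr0.
have Ba : \sum_c B d c * a c = 0.
  transitivity (e (j d) * phi d (\sum_c v c *m P (a c))); last by rewrite sum0 phi0 mulr0.
  rewrite (big_morph _ (phiD d) phi0) mulr_sumr; apply: eq_bigr => c _.
  by rewrite phiM mulrA.
under eq_bigr do rewrite mulrBl; rewrite sumrB Ba subr0 (bigD1 d) //= eqxx scale1r aj.
by rewrite big1 ?addr0 // => c; rewrite eq_sym => /negPf->; rewrite scale0r mul0r.
Qed.

Lemma drop_generator (P : fdmod A) m (v : 'I_m.+1 -> 'rV[K]_(mdim P)) d b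
    (s : 'I_m.+1 -> A) : generates v ->
  v d *m P b = \sum_(c < m) v (lift d c) *m P (s (lift d c)) ->
  (exists t, b * t = 1) -> generates (fun c => v (lift d c)).
Proof.
move=> gen vd [t bt] x; have [a ->] := gen x.
exists (fun c => s (lift d c) * (t * a d) + a (lift d c)).
transitivity (\sum_(c < m) v (lift d c) *m P (s (lift d c) * (t * a d)) +
  \sum_(c < m) v (lift d c) *m P (a (lift d c))); 
  last by rewrite -big_split; apply: eq_bigr => c _; rewrite actD.
rewrite (bigD1_ord d) //=.
congr (_ + _); rewrite -[in LHS](mul1r (a d)) -bt -mulrA actM vd mulmx_suml.
by apply: eq_bigr => c _; rewrite -actM.
Qed.

(** While some nontrivial combination of the generators equals one with radical coefficients, a
    generator [v d] with [l d != 0] is redundant, because [l d - r d] is right invertible. Once no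
    such relation is left, the family is a basis. *)
Lemma generators_basis (P : fdmod A) m (j : 'I_m -> 'I_n)
    (v : 'I_m -> 'rV[K]_(mdim P)) :
  projective_mod P -> (forall c, v c *m P (e (j c)) = v c) -> generates v ->
  exists m' (j' : 'I_m' -> 'I_n) (v' : 'I_m' -> 'rV[K]_(mdim P)), idem_basis j' v'.
Proof.
move=> projP; elim: m j v => [|m IH] j v vj gen.
  by exists 0%N, j, v; split=> // a _ _ [].
have [min|] := classic (forall (l : 'I_m.+1 -> K) (r : 'I_m.+1 -> A),
    (forall c, J 1 (r c)) ->
    \sum_c l c *: v c = \sum_c v c *m P (r c) -> forall c, l c = 0).
  by exists m.+1, j, v; apply: minimal_generators_basis.
move=> /not_all_ex_not [l /not_all_ex_not [r]].
move=> nr; have [rJ nl] := imply_to_and _ _ nr.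
have [lr /not_all_ex_not [d /eqP ld]] := imply_to_and _ _ nl.
apply: (IH (fun c => j (lift d c)) (fun c => v (lift d c))
  (fun c => vj (lift d c))).
apply: (@drop_generator _ _ v d ((l d)%:A - r d) (fun c => r c - (l c)%:A)) => //.
  move: lr; rewrite (bigD1_ord d) //= [RHS](bigD1_ord d) //=.
  move=> /(canRL (addrK _)) lr; rewrite actB actZ act1 lr.
  rewrite addrAC [v d *m _ + _]addrC addrK -sumrB.
  by apply: eq_bigr => c _; rewrite actB actZ act1.
exact: pow1_inverse.
Qed.

Lemma projective_basis (P : fdmod A) : projective_mod P ->
  exists m (j : 'I_m -> 'I_n) (v : 'I_m -> 'rV[K]_(mdim P)), idem_basis j v.
Proof.
move=> projP; pose T : finType := ('I_(mdim P) * 'I_n)%type.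
pose w (t : T) : 'rV[K]_(mdim P) := delta_mx 0 t.1 *m P (e t.2).
apply: (@generators_basis P #|T| (fun c => (enum_val c).2) (fun c => w (enum_val c))) => //.
  by move=> c; rewrite /w -actM (idem_idem F).
move=> x; exists (fun c => x 0 (enum_val c).1 *: e (enum_val c).2).
rewrite -(@reindex _ _ _ _ _ (@enum_val T predT) xpredT (fun t => w t *m P (x 0 t.1 *: e t.2))) /=;
  last exact/onW_bij/enum_val_bij.
rewrite -(pair_bigA _ (fun i k => w (i, k) *m P (x 0 i *: e k))) /=.
rewrite [LHS]row_sum_delta; apply: eq_bigr => i _.
under eq_bigr do rewrite actZ /w /= -actM (idem_idem F); rewrite -scaler_sumr -act_sum.
by rewrite (qf_sum1 F) act1.
Qed.

End ProjectiveBasis.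

(** * Dimension vectors and superfluous kernels *)

Section LinearAlgebra.
Variable K : fieldType.

(** The [X] by [Y] block of [mu] has trivial left kernel, hence full row rank. Taking [l] on all of
    [S] with support in [X] avoids subtypes of arrows and summands. *)
Lemma card_le_of_free (S T : finType) (X : {set S}) (Y : {set T})
    (mu : S -> T -> K) :
  (forall l : S -> K, (forall s, s \notin X -> l s = 0) ->
    (forall t, t \in Y -> \sum_s l s * mu s t = 0) -> forall s, l s = 0) ->
  (#|X| <= #|Y|)%N.
Proof.
move=> free; pose M := \matrix_(p < #|X|, q < #|Y|) mu (enum_val p) (enum_val q).
suff /eqP <- : row_free M by apply: rank_leq_col.
rewrite -kermx_eq0; apply/eqP/row_matrixP => p; rewrite row0.
set u := row p _; have uM : u *m M = 0 by rewrite -row_mul mulmx_ker row0.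
pose l s := \sum_p u 0 p * (enum_val p == s)%:R.
have lE q : l (enum_val q) = u 0 q.
  rewrite /l (bigD1 q) //= eqxx mulr1 big1 ?addr0 // => r ne.
  by rewrite (inj_eq enum_val_inj) (negPf ne) mulr0.
suff l0 : forall s, l s = 0 by apply/rowP => q; rewrite -lE l0 mxE.
apply: free => [s sX|t tY].
  rewrite /l big1 // => q _; case: eqP sX => [<-|_ _]; last by rewrite mulr0.
  by rewrite enum_valP.
transitivity ((u *m M) 0 (enum_rank_in tY t)); last by rewrite uM mxE.
rewrite mxE; under eq_bigr do rewrite mulr_suml.
rewrite exchange_big; apply: eq_bigr => q _ /=.
rewrite (bigD1 (enum_val q)) //= eqxx mulr1 big1 ?addr0; last first.
  by move=> s /negPf; rewrite eq_sym => ->; rewrite mulr0 mul0r.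
by rewrite !mxE enum_rankK_in.
Qed.

(** A matrix with row space inside [V] is enlarged by a missing vector until none is left; [k]
    bounds the remaining codimension. *)
Lemma subspace_matrix p (V : 'rV[K]_p -> Prop) : V 0 ->
  (forall c x y, V x -> V y -> V (c *: x + y)) ->
  exists U : 'M[K]_p, forall x, (x <= U)%MS <-> V x.
Proof.
move=> V0 Vlin.
suff ext k (U : 'M[K]_p) : (forall x, (x <= U)%MS -> V x) -> (p - k <= \rank U)%N ->
    exists U : 'M[K]_p, forall x, (x <= U)%MS <-> V x.
  apply: (ext p 0) => [x|]; last by rewrite subnn.
  by rewrite submx0 => /eqP->.
elim: k U => [|k IH] U sub le.
  exists U => x; split=> [|_]; first exact: sub.
  by apply: submx_full; rewrite /row_full eqn_leq rank_leq_col -[X in (X <= _)%N]subn0.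
have [max|] := classic (forall x, V x -> (x <= U)%MS).
  by exists U => x; split; [apply: sub|apply: max].
move=> /not_all_ex_not [x nx]; have [Vx xU] := imply_to_and _ _ nx.
apply: (IH (U + <<x>>)%MS) => [y /sub_addsmxP [[w1 w2] /= ->]|].
  rewrite addrC; have /sub_rVP [c ->] : (w2 *m <<x>>%MS <= x)%MS.
    by rewrite (submx_trans (submxMl _ _)) ?genmxE.
  by apply: Vlin => //; apply: sub; apply: submxMl.
suff : (\rank U < \rank (U + <<x>>)%MS)%N.
  by move=> lt; apply: leq_trans lt; rewrite leq_subLR addnS -addSn -leq_subLR.
rewrite ltn_neqAle mxrankS ?addsmxSl // andbT.
have [_ ->] := mxrank_leqif_sup (addsmxSl U <<x>>%MS).
apply/negP => h; apply: xU; apply: submx_trans h.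
by apply: submx_trans (addsmxSr _ _); rewrite genmxE.
Qed.

Lemma row_free_injective p q (f : 'M[K]_(p, q)) (x y : 'rV[K]_p) :
  row_free f -> x *m f = y *m f -> x = y.
Proof. by move=> ff; apply: row_free_inj. Qed.

Lemma row_full_surjective p q (f : 'M[K]_(p, q)) (y : 'rV[K]_q) :
  row_full f -> exists x, y = x *m f.
Proof. by move=> ff; apply/submxP/submx_full. Qed.

End LinearAlgebra.

Section Corners.
Variables (K : fieldType) (A : falgType K).
Implicit Types (a b f g : A).

Let lfun_simp := (add_lfunE, opp_lfunE, comp_lfunE, id_lfunE, lfunE).

(** The Peirce component [f A g], spelled as in [cartan_matrix]. *)
Definition corner f g : {vspace A} := (<[f]> * fullv * <[g]>)%VS.

Lemma mem_corner f g a : f * f = f -> g * g = g ->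
  (a \in corner f g) = (f * a * g == a).
Proof.
move=> ff gg; apply/idP/eqP => [|<-]; last first.
  by rewrite !memv_mul ?memv_line ?memvf.
suff sub : (corner f g <= lker (amull f \o amulr g - \1)%VF)%VS.
  move=> /(subvP sub); rewrite memv_ker !lfun_simp /= subr_eq0.
  by rewrite mulrA => /eqP.
apply/prodvP => u _ /[swap] /vlineP [c ->] uf.
have fu : f * u = u.
  suff : (<[f]> * fullv <= lker (amull f - \1)%VF)%VS.
    move=> /subvP /(_ _ uf); rewrite memv_ker !lfun_simp /= subr_eq0.
    by move=> /eqP.
  apply/prodvP => _ w /vlineP [d ->] _; rewrite memv_ker !lfun_simp /=.
  by rewrite mulrA -scalerAr ff subrr.
rewrite memv_ker !lfun_simp /= subr_eq0.
by rewrite -!scalerAr -scalerAl -scalerAr -[u * g * g]mulrA gg mulrA fu.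
Qed.

Lemma mem_cornerM f g a : f * f = f -> g * g = g -> f * a * g \in corner f g.
Proof. by move=> ff gg; rewrite mem_corner // !mulrA ff -mulrA gg. Qed.

End Corners.

Section Exactness.
Variables (K : closedFieldType) (A : falgType K).
Implicit Types (L M N P : fdmod A).

Definition short_exact L M N (i : 'M[K]_(mdim L, mdim M)) (f : 'M[K]_(mdim M, mdim N)) :=
  [/\ [/\ is_hom i & is_hom f], row_free i, row_full f &
      forall x : 'rV_(mdim M), x *m f = 0 <-> exists y, x = y *m i].

Lemma syzygy_exact M L : is_syzygy M L ->
  exists P (f : 'M[K]_(mdim P, mdim M)) (i : 'M[K]_(mdim L, mdim P)),
    [/\ projective_mod P, short_exact i f & superfluous (kermx f)].
Proof.
move=> [P [f [i [[projP fh ff sf] ih iF ik]]]]; exists P, f, i; split=> //.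
split=> // x; split=> [/sub_kermxP|[y ->]].
  by rewrite -(eqmxP ik) => /submxP.
by apply/sub_kermxP; rewrite -(eqmxP ik) submxMl.
Qed.

(** The subspace [M a]; at [a = e k] its dimension is an entry of the dimension vector. *)
Definition component M (a : A) : {vspace 'rV[K]_(mdim M)} :=
  limg (linfun (mulmxr (M a))).

Lemma mem_component M a x : a * a = a -> (x \in component M a) = (x *m M a == x).
Proof.
move=> aa; apply/memv_imgP/eqP => [[y _ ->]|<-]; rewrite ?lfunE /=.
  by rewrite -actM aa.
by exists x; rewrite ?memvf // lfunE.
Qed.

Lemma component_dim_surj M N (f : 'M[K]_(mdim M, mdim N)) a : a * a = a ->
  is_hom f -> row_full f -> \dim (component M a) =
    (\dim (component M a :&: lker (linfun (mulmxr f))) + \dim (component N a))%N.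
Proof.
move=> aa fh ff; rewrite -(limg_ker_dim (linfun (mulmxr f)) (component M a)).
congr (_ + \dim _)%N; apply/vspaceP => y; rewrite mem_component //.
apply/memv_imgP/eqP => [[x]|ya].
  rewrite mem_component // => /eqP xa ->.
  by rewrite lfunE /= -(hom_act _ _ fh) xa.
have [x ex] := row_full_surjective y ff; exists (x *m M a).
  by rewrite mem_component // -actM aa.
by rewrite lfunE /= (hom_act _ _ fh) -ex ya.
Qed.

Lemma component_dim_exact L M N (i : 'M[K]_(mdim L, mdim M))
    (f : 'M[K]_(mdim M, mdim N)) a : a * a = a -> short_exact i f ->
  \dim (component M a) = (\dim (component L a) + \dim (component N a))%N.
Proof.
move=> aa [[ih fh] iF ff ex]; rewrite (component_dim_surj aa fh ff); congr (_ + _)%N.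
have -> : (component M a :&: lker (linfun (mulmxr f)) =
    linfun (mulmxr i) @: component L a)%VS.
  apply/vspaceP => x; rewrite memv_cap memv_ker lfunE /= mem_component //.
  apply/andP/memv_imgP => [[/eqP xa /eqP /ex [y ey]]|[y]].
    exists y; last by rewrite lfunE.
    rewrite mem_component //; apply/eqP/(row_free_injective iF).
    by rewrite (hom_act _ _ ih) -ey.
  rewrite mem_component // lfunE /= => /eqP ya ->; split.
    by rewrite -(hom_act _ _ ih) ya.
  by apply/eqP/ex; exists y.
apply: limg_dim_eq; apply/vspaceP => y; rewrite memv_cap memv_ker lfunE /= memv0.
apply/andP/eqP => [[_ /eqP y0]|->]; last by rewrite mem0v mul0mx.
by apply: (row_free_injective iF); rewrite y0 mul0mx.
Qed.

Lemma component_dim_iso M N a : a * a = a -> mod_iso M N ->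
  \dim (component M a) = \dim (component N a).
Proof.
move=> aa [f [fh fF ff]]; rewrite (component_dim_surj aa fh ff).
suff -> : (component M a :&: lker (linfun (mulmxr f)) = 0)%VS by rewrite dimv0.
apply/vspaceP => y; rewrite memv_cap memv_ker lfunE /= memv0.
apply/andP/eqP => [[_ /eqP y0]|->]; last by rewrite mem0v mul0mx.
by apply: (row_free_injective fF); rewrite y0 mul0mx.
Qed.

End Exactness.

Section BasisProperties.
Variables (K : closedFieldType) (A : falgType K) (n : nat) (Q : quiver n).
Variables (e : 'I_n -> A) (F : quiver_frame Q e).
Notation J := (qf_pow F).
Notation chi := (qf_chi F).
Variables (P : fdmod A) (m : nat) (j : 'I_m -> 'I_n).
Variables (v : 'I_m -> 'rV[K]_(mdim P)) (basis : idem_basis e j v).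

Lemma basis_eq (a b : 'I_m -> A) :
  \sum_c v c *m P (a c) = \sum_c v c *m P (b c) ->
  forall c, e (j c) * a c = e (j c) * b c.
Proof.
move=> eq_ab c; apply/eqP; rewrite -subr_eq0 -mulrBr; apply/eqP.
apply: (idem_basis_free basis (a := fun c => e (j c) * (a c - b c))) => [{}c|].
  by rewrite mulrA (idem_idem F).
under eq_bigr do rewrite actM (idem_basis_idem basis) actB.
by rewrite sumrB eq_ab subrr.
Qed.

(** [P e_k] is the direct sum of the images of the corners [e_(j c) A e_k] under [a |-> v c a], and
    these maps are injective on the corners. *)
Lemma basis_component_dim k :
  \dim (component P (e k)) = (\sum_c \dim (corner (e (j c)) (e k)))%N.
Proof.
pose g c : 'Hom(A, 'rV[K]_(mdim P)) := linfun (fun a => v c *m P a).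
have gE c a : g c a = v c *m P a.
  have lin : linear (fun a => v c *m P a) by move=> t x y; rewrite actD actZ.
  pose gl := GRing.isLinear.Build _ _ _ _ _ lin.
  pose g' : {linear A -> 'rV[K]_(mdim P)} := HB.pack (fun a => v c *m P a) gl.
  by rewrite /g (lfunE g').
have ee i := idem_idem F i.
pose U c := (g c @: corner (e (j c)) (e k))%VS.
have dimU c : \dim (U c) = \dim (corner (e (j c)) (e k)).
  apply: limg_dim_eq; apply/vspaceP => a; rewrite memv_cap memv_ker gE memv0 mem_corner //.
  apply/andP/eqP => [[/eqP ea /eqP a0]|->]; last by rewrite mulr0 mul0r eqxx act0.
  suff e0 : e (j c) * a = 0 by rewrite -ea e0 mul0r.
  have := @basis_eq (fun d => (d == c)%:R *: a) (fun=> 0) _ c.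
  rewrite eqxx scale1r mulr0; apply.
  rewrite (bigD1 c) //= eqxx scale1r a0 add0r !big1 // => [d _|d /negPf->].
    by rewrite act0.
  by rewrite scale0r act0.
have direct : directv (\sum_c U c)%VS.
  apply/directv_sum_independent => us Us sum0 c _.
  have /fin_all_exists [a aE] d : exists a, [/\ e (j d) * a = a & us d = v d *m P a].
    have /memv_imgP [a ac ->] := Us d isT; exists a; split=> //.
    by move: ac; rewrite mem_corner // => /eqP <-; rewrite !mulrA ee.
  have [_ ->] := aE c; have a0 := @idem_basis_free _ _ _ _ _ _ _ _ basis a.
  rewrite a0 ?act0 => [//|d|]; first by have [] := aE d.
  by rewrite -[RHS]sum0; apply: eq_bigr => d _; have [_ ->] := aE d.
under eq_bigr do rewrite -dimU.
rewrite -(directvP direct) /=; apply: (congr1 (fun V => \dim V)).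
apply/vspaceP => x; rewrite mem_component //; apply/eqP/memv_sumP => [xe|[us Us ->]].
  have [a xa] := idem_basis_gen basis x.
  exists (fun c => v c *m P (e (j c) * a c * e k)) => [c _|].
    by rewrite -gE memv_img // mem_cornerM.
  rewrite -xe xa mulmx_suml; apply: eq_bigr => c _.
  by rewrite !actM (idem_basis_idem basis).
rewrite mulmx_suml; apply: eq_bigr => c _.
have /memv_imgP [a ac ->] := Us c isT; rewrite gE -actM.
by move: ac; rewrite mem_corner // => /eqP <-; rewrite -[_ * e k * e k]mulrA ee.
Qed.

(* If x had a coordinate outside the radical, say at c, the submodule of all   *)
(* vectors whose c-th coordinate is in the radical would be a supplement of U. *)
Lemma superfluous_in_radical (U : 'M[K]_(mdim P)) x : superfluous U -> (x <= U)%MS ->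
  exists2 r : 'I_m -> A, (forall c, J 1 (r c)) & x = \sum_c v c *m P (r c).
Proof.
move=> [subU sup] xU; have [a xa] := idem_basis_gen basis x.
have [all_J|] := classic (forall c, J 1 (e (j c) * a c)).
  exists (fun c => e (j c) * a c) => //.
  by rewrite xa; apply: eq_bigr => c _; rewrite actM (idem_basis_idem basis).
move=> /not_all_ex_not [c nJ]; exfalso.
have l0 : chi (j c) (a c) != 0.
  apply/eqP => l0; apply/nJ/pow1P => k; rewrite chiM (qf_chi_idem F).
  by case: eqP => [->|_]; rewrite ?l0 ?mul0r ?mulr0.
pose l := (chi (j c) (a c))^-1.
pose inV x := exists2 b : 'I_m -> A, J 1 (b c) & x = \sum_d v d *m P (b d).
have V0 : inV 0.
  by exists (fun=> 0); [apply: pow0|rewrite big1 // => d _; rewrite act0].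
have Vlin t y z : inV y -> inV z -> inV (t *: y + z).
  move=> [b bJ ->] [b' bJ' ->]; exists (fun d => t *: b d + b' d).
    by apply: qf_powD => //; apply: powZ.
  rewrite scaler_sumr -big_split; apply: eq_bigr => d _ /=.
  by rewrite actD actZ.
have Vact y b : inV y -> inV (y *m P b).
  move=> [b' bJ' ->]; exists (fun d => b' d * b); first exact: powMr.
  by rewrite mulmx_suml; apply: eq_bigr => d _; rewrite actM.
have [V VE] := subspace_matrix V0 Vlin.
have subV : submodule V.
  move=> b; apply/row_subP => k; rewrite row_mul; apply/VE/Vact/VE.
  exact: row_sub.
(* Scaled and cut by [e (j c)] so that its [c]-th coordinate agrees with [e (j c)] modulo the
   radical; hence [v c - y0] lies in [V]. *)
pose y0 := l *: (x *m P (e (j c))).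
have y0U : (y0 <= U)%MS.
  rewrite scalemx_sub //; apply: submx_trans (subU (e (j c))).
  exact: submxMr.
have z0V : inV (v c - y0).
  exists (fun d => (d == c)%:R *: e (j c) - l *: (a d * e (j c))).
    rewrite eqxx scale1r; apply/pow1P => k.
    rewrite chiB chiZ chiM (qf_chi_idem F) /l; case: eqP => [->|_].
      by rewrite mulr1 mulVf // subrr.
    by rewrite !mulr0 subrr.
  under eq_bigr do rewrite actB !actZ actM; rewrite sumrB; congr (_ - _).
    rewrite (bigD1 c) //= eqxx scale1r (idem_basis_idem basis) big1 ?addr0 // => d /negPf->.
    by rewrite scale0r.
  by rewrite /y0 xa mulmx_suml scaler_sumr.
have UVfull : row_full (U + V)%MS.
  rewrite -sub1mx; apply/row_subP => k; have [b ->] := idem_basis_gen basis (row k 1%:M).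
  rewrite (bigD1 c) //= -[v c](subrK y0) mulmxDl addrAC addmx_sub //.
    apply: (submx_trans _ (addsmxSr _ _)); apply/VE.
    rewrite -[X in inV (X + _)]scale1r; apply: Vlin; first exact: Vact.
    exists (fun d => if d == c then 0 else b d); first by rewrite eqxx; apply: pow0.
    rewrite [RHS](bigD1 c) //= eqxx act0 add0r.
    by apply: eq_bigr => d /negPf->.
  apply: (submx_trans _ (addsmxSl _ _)); apply: submx_trans (subU (b c)).
  exact: submxMr.
(* Superfluity puts [v c] itself in [V], which would make [e (j c)] radical. *)
have /VE [b bJ vb] : (v c <= V)%MS by apply: submx_full; apply: sup.
have := @basis_eq (fun d => (d == c)%:R *: e (j c)) b _ c.
rewrite eqxx scale1r (idem_idem F) => eb.
apply: (@idem_notin_pow1 _ _ _ _ _ F (j c)); rewrite eb; first exact: powMl.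
rewrite -vb (bigD1 c) //= eqxx scale1r (idem_basis_idem basis) big1 ?addr0 // => d /negPf->.
by rewrite scale0r act0.
Qed.

Lemma cover_top_free (M : fdmod A) (f : 'M[K]_(mdim P, mdim M)) (l : 'I_m -> K) (r : 'I_m -> A) :
  superfluous (kermx f) -> (forall c, J 1 (r c)) ->
  (\sum_c l c *: v c) *m f = (\sum_c v c *m P (r c)) *m f -> forall c, l c = 0.
Proof.
move=> sup rJ /eqP; rewrite -subr_eq0 -mulmxBl => /eqP /sub_kermxP ker c.
have [s sJ] := superfluous_in_radical sup ker.
move=> /(canRL (subrK _)); rewrite -big_split /= => es.
have := @basis_eq (fun d => (l d)%:A) (fun d => s d + r d) _ c.
rewrite -scalerAr mulr1 => el.
have /pow1P /(_ (j c)) : J 1 (l c *: e (j c)).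
  rewrite el; first by apply: powMl; apply: qf_powD.
  under eq_bigr do rewrite actZ act1; rewrite es.
  by apply: eq_bigr => d _; rewrite actD.
by rewrite chiZ (qf_chi_idem F) eqxx mulr1.
Qed.

End BasisProperties.

(** * Symmetrizing forms *)

Section SymmetricForm.
Variables (K : fieldType) (A : falgType K) (B : {bilinear A -> A -> K^o}).
Hypotheses (formA : forall a b c, B (a * b) c = B a (b * c)).
Hypotheses (formC : forall a b, B a b = B b a).
Hypotheses (form_nondeg : forall a, (forall b, B a b = 0) -> a = 0).

Lemma form_sumr (T : finType) (l : T -> K) (G : T -> A) a :
  B a (\sum_t l t *: G t) = \sum_t l t * B a (G t).
Proof. by rewrite linear_sumr; apply: eq_bigr => t _; rewrite linearZr_LR. Qed.

Lemma form_suml (T : finType) (l : T -> K) (G : T -> A) a :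
  B (\sum_t l t *: G t) a = \sum_t l t * B (G t) a.
Proof. by rewrite formC form_sumr; apply: eq_bigr => t _; rewrite formC. Qed.

Let gram_row (z : 'rV[K]_(dim A)) : 'rV[K]_(dim A) :=
  \row_q B (r2v (delta_mx 0 q)) (r2v z).

Let gram_row_linear : linear gram_row.
Proof.
move=> c y z; apply/rowP => q; rewrite !mxE linearP.
by rewrite linearPr.
Qed.

(** A column of the cokernel matrix of [W] is a functional vanishing on [W] but not at [u];
    nondegeneracy makes it the pairing with some [z]. *)
Lemma form_separation (W : 'M[K]_(dim A)) (u : 'rV[K]_(dim A)) : ~~ (u <= W)%MS ->
  exists z, (forall w : 'rV_(dim A), (w <= W)%MS -> B (r2v w) z = 0) /\ B (r2v u) z != 0.
Proof.
pose gl := GRing.isLinear.Build _ _ _ _ _ gram_row_linear.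
pose g : {linear 'rV[K]_(dim A) -> 'rV[K]_(dim A)} := HB.pack gram_row gl.
pose M := lin1_mx g.
have ME w z : B (r2v w) (r2v z) = (w *m (z *m M)^T) 0 0.
  rewrite mul_rV_lin1 /= !mxE [in LHS](row_sum_delta w) linear_sum.
  under [in LHS]eq_bigr do rewrite linearZ; rewrite form_suml.
  by apply: eq_bigr => q _; rewrite !mxE.
have Mfull : row_full M.
  rewrite -[row_full M]/(row_free M) -kermx_eq0; apply/eqP/row_matrixP => p; rewrite row0.
  set z := row p _; have zM : z *m M = 0 by rewrite -row_mul mulmx_ker row0.
  apply: (can_inj r2vK); rewrite linear0; apply: form_nondeg => b.
  by rewrite formC -[b]v2rK ME zM trmx0 mulmx0 mxE.
rewrite submxE => /eqP nz.
have [k nk] : exists k, (u *m cokermx W) 0 k != 0.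
  apply/existsP; apply: contraT => /existsPn h; case: nz.
  by apply/rowP => k; rewrite [RHS]mxE; apply/eqP/negPn/h.
have [z ez] := row_full_surjective (col k (cokermx W))^T Mfull.
exists (r2v z); split=> [w|].
  by rewrite submxE => /eqP w0; rewrite ME -ez trmxK colE mulmxA w0 mul0mx mxE.
by rewrite ME -ez trmxK colE mulmxA -colE mxE.
Qed.

Variables (n : nat) (Q : quiver n) (e : 'I_n -> A) (F : quiver_frame Q e).
Notation J := (qf_pow F).
Notation chi := (qf_chi F).

(** [B (r * s) b = B (s * (b * r)) 1], and [b * r] is again radical. *)
Lemma annihilator_radical s : (forall r, J 1 r -> s * r = 0) ->
  forall r, J 1 r -> r * s = 0.
Proof.
move=> sJ r rJ; apply: form_nondeg => b.
have br : J 1 (b * r) by apply: powMl.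
by rewrite formC -formA formC -[b * r]mulr1 -formA sJ // linear0l.
Qed.

(** By nilpotency, right multiplication of [e i] by radical elements reaches a nonzero [s] that they
    all kill. For [k] other than [i], [B (s * e k) g = B (s * (e k * g * e i)) 1 = 0], whence
    [s * e i = s]. *)
Lemma socle_element i : exists s,
  [/\ s != 0, e i * s = s, s * e i = s, forall r, J 1 r -> s * r = 0 &
      forall r, J 1 r -> r * s = 0].
Proof.
have [s [s0 es sJ]] : exists s, [/\ s != 0, e i * s = s & forall r, J 1 r -> s * r = 0].
  have [N hN] := qf_nilpotent F.
  have last k a : a != 0 -> e i * a = a -> J (N - k) a ->
      exists s, [/\ s != 0, e i * s = s & forall r, J 1 r -> s * r = 0].
    elim: k a => [|k IH] a a0 ea aJ.
      by rewrite subn0 in aJ; rewrite (hN _ aJ) eqxx in a0.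
    have [all0|] := classic (forall r, J 1 r -> a * r = 0); first by exists a.
    move=> /not_all_ex_not [r nr]; have [rJ /eqP ar0] := imply_to_and _ _ nr.
    apply: (IH (a * r)) => //; first by rewrite mulrA ea.
    have := qf_powM aJ rJ; rewrite addn1.
    have [lt|le] := ltnP k N; first by rewrite subnSK.
    (* Truncated subtraction: for [k >= N] the target [J 0] is the whole algebra. *)
    have /eqP -> : (N - k == 0)%N by rewrite subn_eq0.
    by move=> _; apply: qf_pow_all0.
  apply: (last N (e i)); rewrite ?(idem_idem F) ?subnn //; last exact: qf_pow_all0.
  by apply/eqP => e0; apply: (@idem_notin_pow1 _ _ _ _ _ F i); rewrite e0; apply: pow0.
exists s; split=> //; last exact: annihilator_radical.
rewrite [RHS](sum_idemr F) (bigD1 i) //= big1 ?addr0 // => k ki.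
apply: form_nondeg => g.
have ekg : J 1 (e k * g * e i).
  apply/pow1P => l; rewrite !chiM !(qf_chi_idem F).
  by case: eqP => [->|_]; rewrite ?mul0r // (negPf ki) mulr0.
rewrite formA formC -[in LHS]es -formA formC -[_ * e i]mulr1 -formA.
by rewrite sJ // linear0l.
Qed.

(** For [u] in [e_i A e_k], [B u g = B u (e_k g e_i)], so the pairing of the two corners has no left
    kernel. *)
Lemma corner_dim_le i k :
  (\dim (corner (e i) (e k)) <= \dim (corner (e k) (e i)))%N.
Proof.
set U := corner (e i) (e k); set V := corner (e k) (e i).
have := @card_le_of_free K 'I_(\dim U) 'I_(\dim V) setT setT
  (fun s t => B (vbasis U)`_s (vbasis V)`_t).
rewrite !cardsT !card_ord; apply=> l _ h.
have ee := idem_idem F.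
have /freeP fr := basis_free (vbasisP U); apply: fr; apply: form_nondeg => g.
set u := \sum_s _.
have uU : u \in U by apply: rpred_sum => s _; rewrite rpredZ // vbasis_mem ?mem_nth ?size_tuple.
have V0 w : w \in V -> B u w = 0.
  move=> /coord_vbasis ->; rewrite form_sumr big1 // => t _.
  by rewrite form_suml h ?inE // mulr0.
move: uU; rewrite mem_corner // => /eqP uE.
rewrite -[in LHS]uE -mulrA formC -formA formC formA mulrA.
by rewrite V0 // mem_cornerM.
Qed.

Lemma corner_dimC i k : \dim (corner (e i) (e k)) = \dim (corner (e k) (e i)).
Proof. by apply/eqP; rewrite eqn_leq !corner_dim_le. Qed.

End SymmetricForm.

(** * The simple module at a vertex *)

Section VertexSimple.
Variables (K : closedFieldType) (A : falgType K) (n : nat) (Q : quiver n).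
Variables (e : 'I_n -> A) (F : quiver_frame Q e) (i : 'I_n).

Definition vertex_act (a : A) : 'M[K]_1 := (qf_chi F i a)%:M.

Lemma vertex_act_linear : linear vertex_act.
Proof.
by move=> c a b; rewrite /vertex_act chiD chiZ raddfD /= scale_scalar_mx.
Qed.

Lemma vertex_act_mult : monoid_morphism vertex_act.
Proof.
split=> [|a b]; rewrite /vertex_act ?chi1 // chiM.
by rewrite scalar_mxM.
Qed.

HB.instance Definition _ :=
  GRing.isLinear.Build K A 'M[K]_1 *:%R vertex_act vertex_act_linear.
HB.instance Definition _ :=
  GRing.isMonoidMorphism.Build A 'M[K]_1 vertex_act vertex_act_mult.

Definition vertex_simple : fdmod A := FdMod vertex_act.

Lemma vertex_simple_act (x : 'rV[K]_(mdim vertex_simple)) a :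
  x *m vertex_simple a = qf_chi F i a *: x.
Proof. exact: mul_mx_scalar. Qed.

Lemma vertex_simple_simple : simple_mod vertex_simple.
Proof.
split=> // U _; have [->|U0] := eqVneq U 0; [by left|right].
by rewrite /row_full eqn_leq rank_leq_col lt0n mxrank_eq0.
Qed.

End VertexSimple.

(** * The minimal resolution of a simple module *)

Section Resolution.
Variables (K : closedFieldType) (A : falgType K) (n : nat) (Q : quiver n).
Variables (e : 'I_n -> A) (F : quiver_frame Q e) (i : 'I_n).
Notation J := (qf_pow F).
Notation chi := (qf_chi F).
Notation S := (vertex_simple F i).

Lemma sum_single m (c0 : 'I_m) (V : nmodType) (G : 'I_m -> V) :
  (forall c, c = c0) -> \sum_c G c = G c0.
Proof.
move=> all0; rewrite (bigD1 c0) //= big1 ?addr0 // => c.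
by rewrite (all0 c) eqxx.
Qed.

Lemma sum_delta m (c : 'I_m) (V : lmodType K) (G : 'I_m -> V) :
  \sum_d (d == c)%:R *: G d = G c.
Proof.
rewrite (bigD1 c) //= eqxx scale1r big1 ?addr0 // => d /negPf->.
by rewrite scale0r.
Qed.

Lemma collinear_rV1 (x y : 'rV[K]_1) : y != 0 -> exists c, x = c *: y.
Proof.
move=> y0; have y00 : y 0 0 != 0.
  by apply: contra y0 => /eqP y00; apply/eqP/rowP => k; rewrite ord1 y00 mxE.
by exists (x 0 0 / y 0 0); apply/rowP => k; rewrite ord1 mxE divfK.
Qed.

Lemma simple_iso_properties L : mod_iso L S ->
  [/\ forall (x : 'rV_(mdim L)) a, x *m L a = chi i a *: x,
      forall x y : 'rV[K]_(mdim L), y != 0 -> exists c, x = c *: y &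
      exists x : 'rV[K]_(mdim L), x != 0].
Proof.
move=> [h [hh hF hf]]; split=> [x a|x y y0|].
- by apply: (row_free_injective hF); rewrite (hom_act _ _ hh) vertex_simple_act scalemxAl.
- have yh : y *m h != 0 by rewrite mulmx_free_eq0.
  have [c hc] := collinear_rV1 (x *m h) yh; exists c.
  by apply: (row_free_injective hF); rewrite -scalemxAl.
have [x ex] := row_full_surjective (const_mx 1 : 'rV[K]_1) hf; exists x.
apply/eqP => x0; move: ex; rewrite x0 mul0mx => /rowP /(_ 0) /eqP.
by rewrite !mxE oner_eq0.
Qed.

(** The images of the generators are independent in the one-dimensional [S], so at most one exists,
    and surjectivity of [f] requires one. Since [e (j c)] fixes its nonzero image, [j c = i]. *)
Lemma first_term (P : fdmod A) m (j : 'I_m -> 'I_n) (v : 'I_m -> 'rV[K]_(mdim P))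
    (f : 'M[K]_(mdim P, mdim S)) :
  idem_basis e j v -> is_hom f -> row_full f -> superfluous (kermx f) ->
  exists c0, [/\ forall c, c = c0, j c0 = i & v c0 *m f != 0].
Proof.
move=> basis fh ff sup.
have free l : (\sum_c l c *: v c) *m f = 0 -> forall c, l c = 0.
  move=> l0; have := @cover_top_free _ _ _ _ _ F _ _ _ _ basis _ f l (fun=> 0).
  apply=> // [c|].
    exact: pow0.
  by rewrite l0 big1 ?mul0mx // => c _; rewrite act0.
have f0 c : v c *m f != 0.
  apply/eqP => vf; have := free (fun d => (d == c)%:R).
  by rewrite sum_delta => /(_ vf c) /eqP; rewrite eqxx oner_eq0.
have ji c : j c = i.
  apply/esym/eqP; apply: contraT => ne.
  have := hom_act (v c) (e (j c)) fh.
  rewrite (idem_basis_idem basis) vertex_simple_act (qf_chi_idem F) (negPf ne).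
  by rewrite scale0r => /eqP; rewrite (negPf (f0 c)).
have all_eq (c d : 'I_m) : c = d.
  apply/eqP; apply: contraT => ne.
  have [t et] := collinear_rV1 (v c *m f) (f0 d).
  have /(_ _ c) := free (fun x => (x == c)%:R - t * (x == d)%:R).
  under eq_bigr do rewrite scalerBl -scalerA.
  rewrite sumrB -scaler_sumr !sum_delta mulmxBl et -scalemxAl subrr => /(_ erefl) /eqP.
  by rewrite eqxx (negPf ne) mulr0 subr0 oner_eq0.
case: m j v basis {free} f0 ji all_eq => [|m] j v basis f0 ji all_eq; last first.
  by exists ord0.
have [x ex] := row_full_surjective (const_mx 1 : 'rV[K]_1) ff.
have [a xa] := idem_basis_gen basis x.
move: ex; rewrite xa big_ord0 mul0mx => /rowP /(_ 0) /eqP.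
by rewrite !mxE oner_eq0.
Qed.

(** [P1] covers the radical of [e_i A]. Its generators with [j1 c = k] give elements [z c] of
    [e_i J e_k] that are independent modulo the square of the radical, where the arrows from [i] to
    [k] span; [mu] holds the coefficients. *)
Lemma second_term_bound (P0 L1 P1 : fdmod A) m0 (j0 : 'I_m0 -> 'I_n)
    (v0 : 'I_m0 -> 'rV[K]_(mdim P0)) (f0 : 'M[K]_(mdim P0, mdim S))
    (i0 : 'M[K]_(mdim L1, mdim P0)) m1 (j1 : 'I_m1 -> 'I_n)
    (v1 : 'I_m1 -> 'rV[K]_(mdim P1)) (f1 : 'M[K]_(mdim P1, mdim L1)) k :
  idem_basis e j0 v0 -> short_exact i0 f0 -> superfluous (kermx f0) ->
  idem_basis e j1 v1 -> is_hom f1 -> row_full f1 -> superfluous (kermx f1) ->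
  (#|[set c | j1 c == k]| <= #|[set a : arrow Q | (src a == i) && (tgt a == k)]|)%N.
Proof.
move=> basis0 [[ih fh] iF ff ex] sup0 basis1 f1h f1f sup1.
have [c0 [single j0i vf0]] := first_term basis0 fh ff sup0.
pose w := v0 c0.
have we : w *m P0 (e i) = w by rewrite -j0i (idem_basis_idem basis0).
have ker a : w *m P0 a *m f0 = chi i a *: (w *m f0).
  by rewrite (hom_act _ _ fh) vertex_simple_act.
have zP c : exists z, [/\ J 1 z, e i * z = z, z * e (j1 c) = z &
    v1 c *m f1 *m i0 = w *m P0 z].
  have [a] := idem_basis_gen basis0 (v1 c *m f1 *m i0).
  rewrite (sum_single _ single) => za.
  have chia : chi i (a c0) = 0.
    have /eqP : chi i (a c0) *: (w *m f0) = 0.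
      by rewrite -ker -za; apply/ex; exists (v1 c *m f1).
    by rewrite scaler_eq0 (negPf vf0) orbF => /eqP.
  exists (e i * a c0 * e (j1 c)); split; rewrite ?mulrA ?(idem_idem F) //.
  - apply/pow1P => l; rewrite !chiM (qf_chi_idem F).
    by case: eqP => [->|_]; rewrite ?chia ?mulr0 !mul0r.
  - by rewrite -[_ * e _ * e _]mulrA (idem_idem F).
  by rewrite !actM we -za -!hom_act // (idem_basis_idem basis1).
have /fin_all_exists [z zE] := zP.
have /fin_all_exists [mu muE] c : exists mu : arrow Q -> K,
    J 2 (z c - \sum_a mu a *: qf_arrow F a).
  by have [zJ _ _ _] := zE c; apply: qf_head1.
apply: (card_le_of_free (mu := mu)) => l lX lmu.
pose x := \sum_c l c *: z c.
have x2 : J 2 x.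
  pose D := \sum_c l c *: (z c - \sum_a mu c a *: qf_arrow F a).
  have DJ : J 2 D by apply: pow_sum => c _; apply: powZ.
  (* The idempotents remove all arrows except those from [i] to [k], whose coefficients vanish by
     [lmu]. *)
  suff -> : x = e i * D * e k by apply: powMr; apply: powMl.
  have -> : D = x - \sum_a (\sum_c l c * mu c a) *: qf_arrow F a.
    rewrite /D; under eq_bigr do rewrite scalerBr scaler_sumr.
    rewrite sumrB exchange_big; congr (_ - _); apply: eq_bigr => a _ /=.
    by rewrite scaler_suml; apply: eq_bigr => c _; rewrite scalerA.
  rewrite mulrBr mulrBl [X in _ - X](_ : _ = 0) ?subr0.
    rewrite /x mulr_sumr mulr_suml; apply: eq_bigr => c _.
    have [_ ez ze _] := zE c; rewrite -scalerAr -scalerAl ez.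
    have [/eqP <-|ne] := boolP (j1 c == k); first by rewrite ze.
    by rewrite lX ?inE // !scale0r.
  rewrite mulr_sumr mulr_suml big1 // => a _.
  rewrite -scalerAr -scalerAl (qf_idem_arrow F).
  have [|] := boolP (a \in [set a : arrow Q | (src a == i) && (tgt a == k)]).
    by move=> /lmu ->; rewrite scale0r.
  rewrite inE [i == _]eq_sym; case: (src a == i) => /= ne.
    by rewrite (qf_arrow_idem F) (negPf ne) scaler0.
  by rewrite mul0r scaler0.
have [s sJ xs] := qf_factor x2.
(* Each [w] times an arrow lies in the kernel of [f0] and so comes from [P1]; factoring [x] through
   arrows then gives radical coefficients on the [v1 c]. *)
have /fin_all_exists [b bE] a : exists b : 'I_m1 -> A,
    w *m P0 (qf_arrow F a) = (\sum_c v1 c *m P1 (b c)) *m f1 *m i0.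
  have /ex [y ->] : w *m P0 (qf_arrow F a) *m f0 = 0.
    by rewrite ker (qf_chi_pow1 _ (qf_arrow_pow1 F a)) scale0r.
  have [u ->] := row_full_surjective y f1f.
  by have [c ->] := idem_basis_gen basis1 u; exists c.
have := @cover_top_free _ _ _ _ _ F _ _ _ _ basis1 _ f1 l
  (fun c => \sum_a b a c * s a).
apply=> // [c|].
  by apply: pow_sum => a _; apply: powMl.
apply: (row_free_injective iF); transitivity (w *m P0 x).
  rewrite !mulmx_suml /x act_sum; apply: eq_bigr => c _.
  by have [_ _ _ zc] := zE c; rewrite -!scalemxAl zc actZ.
rewrite xs act_sum; under eq_bigr do rewrite actM bE -!hom_act //.
rewrite -!mulmx_suml; do 2!congr (_ *m _).
under eq_bigr do rewrite mulmx_suml.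
rewrite exchange_big; apply: eq_bigr => c _ /=.
by rewrite act_sum; apply: eq_bigr => a _; rewrite actM.
Qed.

Variable B : {bilinear A -> A -> K^o}.
Hypotheses (formA : forall a b c, B (a * b) c = B a (b * c)).
Hypotheses (formC : forall a b, B a b = B b a).
Hypotheses (form_nondeg : forall a, (forall b, B a b = 0) -> a = 0).

(** The last hypothesis puts socle elements of [P3] in the image of [L4], one copy of [S]. Every
    summand [e_(j c) A] contributes a nonzero one on which [e (j c)] acts as the identity, so there
    is a single summand, and [j c = i]. *)
Lemma last_term (L4 P3 L3 : fdmod A) m (j : 'I_m -> 'I_n)
    (v : 'I_m -> 'rV[K]_(mdim P3)) (i4 : 'M[K]_(mdim L4, mdim P3))
    (f3 : 'M[K]_(mdim P3, mdim L3)) :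
  idem_basis e j v -> short_exact i4 f3 -> mod_iso L4 S ->
  (forall (x : 'rV_(mdim P3)) s, (forall r, J 1 r -> r * s = 0) -> x *m P3 s *m f3 = 0) ->
  exists2 c0 : 'I_m, forall c, c = c0 & j c0 = i.
Proof.
move=> basis [[ih fh] iF ff ex] iso socle_ker.
have [act4 line4 [x4 x40]] := simple_iso_properties iso.
have free1 c a : e (j c) * a = a -> v c *m P3 a = 0 -> a = 0.
  move=> ea va; have := basis_eq F basis (a := fun d => (d == c)%:R *: a) (b := fun=> 0).
  move=> /(_ _ c); rewrite eqxx scale1r ea mulr0; apply.
  under eq_bigr do rewrite actZ; rewrite sum_delta va big1 // => d _.
  by rewrite act0.
have yP c : exists2 y : 'rV[K]_(mdim L4), y != 0 /\ j c = i & exists2 s,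
    y *m i4 = v c *m P3 s & s != 0 /\ e (j c) * s = s.
  have [s [s0 es se sJ Js]] := socle_element formA formC form_nondeg F (j c).
  have /ex [y ey] := socle_ker (v c) s Js.
  exists y; last by exists s.
  have y0 : y != 0.
    apply/eqP => y0; case/eqP: s0; apply: (free1 c) => //.
    by rewrite ey y0 mul0mx.
  split=> //; apply/esym/eqP; apply: contraT => ne; case/eqP: y0.
  apply: (row_free_injective iF); rewrite mul0mx -[RHS](mul0mx _ i4).
  rewrite -[in RHS](scale0r y).
  have <- : chi i (e (j c)) = 0 by rewrite (qf_chi_idem F) (negPf ne).
  by rewrite -act4 (hom_act _ _ ih) -ey -actM se.
have all_eq (c d : 'I_m) : c = d.
  apply/eqP; apply: contraT => ne.
  have [yc [_ jc] [s ys [s0 es]]] := yP c; have [yd [yd0 jd] [s' ys' [_ es']]] := yP d.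
  have [t et] := line4 yc yd yd0.
  case/eqP: s0; rewrite -es.
  have := basis_eq F basis (a := fun x => (x == c)%:R *: s)
    (b := fun x => (x == d)%:R *: (t *: s')).
  move=> /(_ _ c); rewrite eqxx scale1r (negPf ne) scale0r mulr0; apply.
  under eq_bigr do rewrite actZ; under [RHS]eq_bigr do rewrite actZ.
  by rewrite !sum_delta -ys et actZ -ys' scalemxAl.
case: m j v basis free1 yP all_eq => [|m] j v basis free1 yP all_eq; last first.
  by exists ord0 => //; have [y [_ ->]] := yP ord0.
case/eqP: x40; apply: (row_free_injective iF); rewrite mul0mx.
by have [a ->] := idem_basis_gen basis (x4 *m i4); rewrite big_ord0.
Qed.

(** Let [y b] be the coordinates in [P2] of the image of the generator of [P3]; minimality makes
    them radical. By exactness at [P3], their common right annihilator in [e_i A] lies in the socle,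
    and orthogonality for [B] then shows that they generate [J e_i] as a left ideal. Modulo the
    square of the radical, an arrow from [k] to [i] is thus a combination of the [y b] with
    [j2 b = k]. *)
Lemma third_term_bound (L4 P3 L3 P2 L2 : fdmod A) m3 (j3 : 'I_m3 -> 'I_n)
    (v3 : 'I_m3 -> 'rV[K]_(mdim P3)) (i4 : 'M[K]_(mdim L4, mdim P3))
    (f3 : 'M[K]_(mdim P3, mdim L3)) (i3 : 'M[K]_(mdim L3, mdim P2))
    m2 (j2 : 'I_m2 -> 'I_n) (v2 : 'I_m2 -> 'rV[K]_(mdim P2))
    (f2 : 'M[K]_(mdim P2, mdim L2)) :
  idem_basis e j3 v3 -> short_exact i4 f3 -> mod_iso L4 S ->
  idem_basis e j2 v2 -> short_exact i3 f2 -> superfluous (kermx f2) ->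
  (exists2 c0 : 'I_m3, forall c, c = c0 & j3 c0 = i) /\
  forall k, (#|[set a : arrow Q | (src a == k) && (tgt a == i)]| <=
             #|[set b | j2 b == k]|)%N.
Proof.
move=> basis3 ex3 iso basis2 ex2 sup2.
have [[i4h f3h] i4F f3f ker3] := ex3; have [[i3h f2h] i3F f2f ker2] := ex2.
have radical (x : 'rV_(mdim P3)) : exists2 r : 'I_m2 -> A, (forall b, J 1 (r b)) &
    x *m f3 *m i3 = \sum_b v2 b *m P2 (r b).
  apply: (superfluous_in_radical F basis2 sup2); apply/sub_kermxP/ker2.
  by exists (x *m f3).
have [c0 single j3i] : exists2 c0 : 'I_m3, forall c, c = c0 & j3 c0 = i.
  apply: (last_term basis3 ex3 iso) => x s Js.
  apply: (row_free_injective i3F); rewrite mul0mx !hom_act //.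
  have [r rJ ->] := radical x; rewrite mulmx_suml big1 // => b _.
  by rewrite -actM Js // act0.
split; first by exists c0.
pose w := v3 c0.
have we : w *m P3 (e i) = w by rewrite -j3i (idem_basis_idem basis3).
have [y0 y0J wy0] := radical w.
pose y b := e (j2 b) * y0 b * e i.
have yJ b : J 1 (y b) by apply: powMr; apply: powMl.
have ye b : y b * e i = y b by rewrite -mulrA (idem_idem F).
have wy : w *m f3 *m i3 = \sum_b v2 b *m P2 (y b).
  rewrite -we !hom_act // wy0 mulmx_suml; apply: eq_bigr => b _.
  by rewrite /y !actM (idem_basis_idem basis2).
have [act4 _ _] := simple_iso_properties iso.
have soc z : e i * z = z -> (forall b, y b * z = 0) -> forall r, J 1 r -> z * r = 0.
  move=> ez yz r rJ.
  have /ker3 [u eu] : w *m P3 z *m f3 = 0.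
    apply: (row_free_injective i3F); rewrite mul0mx !hom_act // wy mulmx_suml.
    by rewrite big1 // => b _; rewrite -actM yz act0.
  have wzr : w *m P3 (z * r) = 0.
    by rewrite actM eu -(hom_act _ _ i4h) act4 (qf_chi_pow1 i rJ) scale0r mul0mx.
  have := basis_eq F basis3 (a := fun=> z * r) (b := fun=> 0) _ c0.
  rewrite !(sum_single _ single) -/w wzr act0 j3i mulrA ez mulr0; exact.
have gen r : J 1 r -> exists g : 'I_m2 -> A, r * e i = \sum_b g b * y b.
  move=> rJ.
  have [||W WE] := @subspace_matrix K (dim A)
      (fun u => exists g : 'I_m2 -> A, r2v u = \sum_b g b * y b).
  - by exists (fun=> 0); rewrite linear0 big1 // => b _; rewrite mul0r.
  - move=> t u u' [g gE] [g' gE']; exists (fun b => t *: g b + g' b).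
    rewrite linearP /= gE gE' scaler_sumr -big_split; apply: eq_bigr => b _ /=.
    by rewrite mulrDl scalerAl.
  (* Otherwise some [z] is orthogonal to the left ideal but not to [r * e i]. Orthogonality gives
     [y b * z = 0], so [e i * z] lies in the socle and [B (r * e i) z = B (e i * z * r) 1]
     vanishes. *)
  rewrite -[r * e i]v2rK; apply/WE; apply: contraT => nW.
  have [z [Wz /eqP]] := form_separation formC form_nondeg nW; case.
  have yz b : y b * z = 0.
    apply: form_nondeg => g; rewrite formC -formA -[g * y b]v2rK.
    apply: Wz; apply/WE; exists (fun d => (d == b)%:R *: g).
    rewrite v2rK; under eq_bigr do rewrite -scalerAl.
    by rewrite sum_delta.
  have ezr : e i * z * r = 0.
    apply: soc => // [|b]; first by rewrite mulrA (idem_idem F).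
    by rewrite mulrA ye yz.
  by rewrite v2rK formA formC -[r]mulr1 -formA ezr linear0l.
move=> k.
have /fin_all_exists [g gE] a : exists g : 'I_m2 -> A,
    qf_arrow F a * e i = \sum_b g b * y b by apply: gen; apply: qf_arrow_pow1.
pose mu a b := chi k (g a b).
apply: (card_le_of_free (mu := mu)) => l lX lmu.
apply: (qf_arrow_free (q := F)).
(* Each bracket is radical, since the subtracted term is the scalar part of
   [e k * g a b * e (j2 b)]. The subtracted terms cancel in the sum over [a] by [lmu]. *)
suff -> : \sum_a l a *: qf_arrow F a =
    \sum_a l a *: \sum_b (e k * g a b * e (j2 b) - (k == j2 b)%:R *: (mu a b *: e k)) * y b.
  apply: pow_sum => a _; apply: powZ; apply: pow_sum => b _.
  apply: (@qf_powM _ _ _ _ _ F 1 1) => //; apply/pow1P => p.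
  rewrite chiB !chiZ !chiM !(qf_chi_idem F) /mu [p == j2 b]eq_sym.
  case: (eqVneq p k) => [->|_]; last by rewrite !mul0r !mulr0 subrr.
  by rewrite mul1r mulr1 mulrC [j2 b == k]eq_sym subrr.
transitivity (\sum_a l a *: (e k * (qf_arrow F a * e i))).
  apply: eq_bigr => a _; rewrite (qf_arrow_idem F).
  have [|ne] := boolP (a \in [set a : arrow Q | (src a == k) && (tgt a == i)]); last first.
    by rewrite lX ?scale0r.
  rewrite inE => /andP [/eqP sa /eqP ta].
  by rewrite ta eqxx (qf_idem_arrow F) sa eqxx.
under [RHS]eq_bigr => a _.
  under eq_bigr => b _ do rewrite mulrBl.
  rewrite sumrB scalerBr.
  over.
rewrite sumrB [X in _ - X](_ : _ = 0) ?subr0.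
  apply: eq_bigr => a _; rewrite gE mulr_sumr; congr (_ *: _).
  by apply: eq_bigr => b _; rewrite /y !mulrA -[_ * e (j2 b) * e (j2 b)]mulrA (idem_idem F).
under eq_bigr do rewrite scaler_sumr.
rewrite exchange_big big1 // => b _ /=.
have [kb|ne] := eqVneq k (j2 b); last first.
  by rewrite big1 // => a _; rewrite scale0r mul0r scaler0.
under eq_bigr do rewrite scale1r -scalerAl scalerA.
by rewrite -scaler_suml lmu ?scale0r // inE kb.
Qed.

End Resolution.

(** * The matrix inequality *)

(** [C W C = C (q - q^T) C] because [p C = x C]; it is both nonnegative and antisymmetric, hence
    zero. Its entries dominate [C i i * W i j * C j j], so the positive diagonal forces [W = 0], and
    both nonnegative summands of [W] vanish. *)
Lemma antisymmetric_squeeze (N : nat) (C q p x : 'M[int]_N) :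
  C^T = C -> (forall i j, 0 <= C i j) -> (forall i, 0 < C i i) ->
  p *m C = x *m C -> (forall i j, p i j <= q i j) -> (forall i j, q j i <= x i j) ->
  (q - q^T) *m C = 0.
Proof.
move=> Csym C0 Cpos pC pq qx.
pose W := (q - p) + (x - q^T).
have W0 i j : 0 <= W i j.
  by rewrite !mxE addr_ge0 // subr_ge0 ?pq ?qx.
have CWC : C *m W *m C = C *m (q - q^T) *m C.
  have -> : W = (q - q^T) + (x - p) by rewrite /W [x - _]addrC addrACA [- p + _]addrC.
  by rewrite mulmxDr mulmxDl -[X in _ + X]mulmxA mulmxBl pC subrr mulmx0 addr0.
have CWC0 i j : 0 <= (C *m W *m C) i j.
  rewrite mxE; apply: sumr_ge0 => k _; apply: mulr_ge0 => //.
  by rewrite mxE; apply: sumr_ge0 => l _; apply: mulr_ge0.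
have CWCT : (C *m W *m C)^T = - (C *m W *m C).
  rewrite CWC !trmx_mul Csym linearB /= trmxK mulmxA.
  by rewrite -[q^T - q]opprB mulmxN mulNmx.
have CWCz i j : (C *m W *m C) i j = 0.
  apply/le_anti; rewrite CWC0 andbT -oppr_ge0.
  by have /matrixP /(_ i j) := CWCT; rewrite !mxE => <-; have := CWC0 j i; rewrite mxE.
have Wz i j : W i j = 0.
  apply/le_anti; rewrite W0 andbT.
  have : C i i * W i j * C j j <= 0.
    rewrite -(CWCz i j) [leRHS]mxE (bigD1 j) //= ler_wpDr //.
      apply: sumr_ge0 => k _; apply: mulr_ge0 => //.
      by rewrite mxE; apply: sumr_ge0 => l _; apply: mulr_ge0.
    rewrite ler_wpM2r // [leRHS]mxE (bigD1 i) //= ler_wpDr //.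
    by apply: sumr_ge0 => k _; apply: mulr_ge0.
  by rewrite pmulr_lle0 // pmulr_rle0.
have pE : p = q.
  apply/matrixP => i j; apply/le_anti; rewrite pq -subr_ge0.
  have := Wz i j; rewrite /W !mxE => /eqP; rewrite addr_eq0 => /eqP e.
  by rewrite -opprB e opprK subr_ge0 qx.
have xE : x = q^T.
  by apply/matrixP => i j; have := Wz i j; rewrite /W pE subrr add0r !mxE => /subr0_eq.
by rewrite mulmxBl -{1}pE -xE pC subrr.
Qed.

(** * Multiplicities in the resolution and conclusion *)

Section Counting.
Variables (K : closedFieldType) (A : falgType K) (n : nat) (Q : quiver n).
Variables (e : 'I_n -> A) (F : quiver_frame Q e).
Variable B : {bilinear A -> A -> K^o}.
Hypotheses (formA : forall a b c, B (a * b) c = B a (b * c)).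
Hypotheses (formC : forall a b, B a b = B b a).
Hypotheses (form_nondeg : forall a, (forall b, B a b = 0) -> a = 0).

Lemma basis_component_count (P : fdmod A) m (j : 'I_m -> 'I_n)
    (v : 'I_m -> 'rV[K]_(mdim P)) k : idem_basis e j v ->
  \dim (component P (e k)) =
    (\sum_l #|[set c | j c == l]| * \dim (corner (e l) (e k)))%N.
Proof.
move=> basis; rewrite (basis_component_dim F basis) (partition_big j xpredT) //=.
apply: eq_bigr => l _; rewrite -sum_nat_cond_const.
by apply: eq_big => [c|c /eqP->] //; rewrite inE.
Qed.

(** [px] holds the multiplicities of the [e_l A] in [P1] and [P2]. Along the exact sequence, [P0]
    cancels against [P3] and the two copies of [S] against each other. *)
Lemma resolution_counts i :
  is_syzygy_pow 4 (vertex_simple F i) (vertex_simple F i) ->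
  exists px : ('I_n -> nat) * ('I_n -> nat), forall k,
    [/\ (\sum_l px.1 l * \dim (corner (e l) (e k)) =
          \sum_l px.2 l * \dim (corner (e l) (e k)))%N,
        (px.1 k <= #|[set a : arrow Q | (src a == i) && (tgt a == k)]|)%N &
        (#|[set a : arrow Q | (src a == k) && (tgt a == i)]| <= px.2 k)%N].
Proof.
move=> [L1 /syzygy_exact [P0 [f0 [i0 [proj0 ex0 sup0]]]]].
move=> [L2 /syzygy_exact [P1 [f1 [i1 [proj1 ex1 sup1]]]]].
move=> [L3 /syzygy_exact [P2 [f2 [i2 [proj2 ex2 sup2]]]]].
move=> [L4 /syzygy_exact [P3 [f3 [i3 [proj3 ex3 sup3]]]] iso].
have [m0 [j0 [v0 basis0]]] := projective_basis F proj0.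
have [m1 [j1 [v1 basis1]]] := projective_basis F proj1.
have [m2 [j2 [v2 basis2]]] := projective_basis F proj2.
have [m3 [j3 [v3 basis3]]] := projective_basis F proj3.
have [[_ f0h] _ f0f _] := ex0; have [[_ f1h] _ f1f _] := ex1.
have [c0 [single0 j0i _]] := first_term basis0 f0h f0f sup0.
have [[c3 single3 j3i] lower] :=
  third_term_bound formA formC form_nondeg basis3 ex3 iso basis2 ex2 sup2.
exists (fun l => #|[set c | j1 c == l]|, fun l => #|[set c | j2 c == l]|) => k /=.
split; last exact: lower.
  rewrite -(basis_component_count _ basis1) -(basis_component_count _ basis2).
  have ek := idem_idem F k.
  have := component_dim_exact ek ex0; have := component_dim_exact ek ex1.
  have := component_dim_exact ek ex2; have := component_dim_exact ek ex3.
  rewrite (component_dim_iso ek iso) (basis_component_dim F basis0).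
  rewrite (basis_component_dim F basis3) (sum_single _ single0) (sum_single _ single3).
  rewrite j0i j3i => d3 d2 d1 d0.
  (* To cancel in [nat], the dimension of [e_i A e_k] is added to both sides, read through [P3] on
     the left and [P0] on the right. *)
  apply/eqP; rewrite -(eqn_add2r (\dim (corner (e i) (e k)))).
  rewrite [in X in X == _]d3 d2 d1 d0; apply/eqP.
  by rewrite addnACA [RHS]addnACA [RHS]addnC [in RHS](addnC (\dim (component L3 _))).
exact: second_term_bound basis0 ex0 sup0 basis1 f1h f1f sup1.
Qed.

End Counting.

Theorem theorem2p2 (K : closedFieldType) (n : nat) (Q : quiver n.+1)
    (I : pathalg K Q -> Prop) (Lambda : falgType K)
    (phi : {lrmorphism pathalg K Q -> Lambda}) :
  admissible_ideal I ->
  presents I phi ->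
  basic_algebra Lambda ->
  generalized_quaternion_type Lambda ->
  signed_adjacency Q *m cartan_matrix phi = 0.
Proof.
move=> adm pres _ gqt; have F := frame_of_presentation adm pres.
have [B [formA formC form_nondeg]] := gqt_symmetric gqt.
set e := vertex_idempotent phi in F *.
have /fin_all_exists [px pxE] i : exists px : ('I_n.+1 -> nat) * ('I_n.+1 -> nat),
    forall k,
    [/\ (\sum_l px.1 l * \dim (corner (e l) (e k)) =
          \sum_l px.2 l * \dim (corner (e l) (e k)))%N,
        (px.1 k <= #|[set a : arrow Q | (src a == i) && (tgt a == k)]|)%N &
        (#|[set a : arrow Q | (src a == k) && (tgt a == i)]| <= px.2 k)%N].
  apply: (resolution_counts formA formC form_nondeg (F := F)).
  by have [] := gqt_periodic gqt (vertex_simple_simple F i).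
apply: (@antisymmetric_squeeze _ _ _ (\matrix_(i, k) ((px i).1 k)%:Z)
  (\matrix_(i, k) ((px i).2 k)%:Z)).
- apply/matrixP => i k; rewrite !mxE; congr (_%:Z).
  exact: (corner_dimC formA formC form_nondeg F).
- by move=> i k; rewrite mxE.
- move=> i; rewrite mxE ltz_nat lt0n dimv_eq0.
  apply/eqP => c0; have ee := idem_idem F i.
  have : e i \in corner (e i) (e i) by rewrite mem_corner // !ee.
  rewrite /corner c0 memv0 => /eqP e0.
  by apply: (@idem_notin_pow1 _ _ _ _ _ F i); rewrite e0; apply: pow0.
- apply/matrixP => i k; have [eq_px _ _] := pxE i k.
  (* The Cartan entry at [l k] is the dimension of [e_k A e_l], whereas the counts use [e_l A e_k];
     [corner_dimC] identifies them. *)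
  have toZ (x : 'I_n.+1 -> nat) : \sum_l (x l)%:Z * cartan_matrix phi l k =
      (\sum_l x l * \dim (corner (e l) (e k)))%N%:Z.
    rewrite (big_morph Posz PoszD (erefl _)); apply: eq_bigr => l _.
    rewrite mxE PoszM; congr (_ * Posz _).
    exact: (corner_dimC formA formC form_nondeg F).
  rewrite [LHS]mxE [RHS]mxE.
  transitivity (\sum_l ((px i).1 l)%:Z * cartan_matrix phi l k).
    by apply: eq_bigr => l _; congr (_ * _); rewrite mxE.
  by rewrite toZ eq_px -toZ; apply: eq_bigr => l _; congr (_ * _); rewrite mxE.
- by move=> i k; rewrite !mxE lez_nat; have [] := pxE i k.
- by move=> i k; rewrite !mxE lez_nat; have [] := pxE i k.
Qed.
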